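(* For the symbol-comparison cost function $\beta=\beta_{\mathrm{symb}}$ of an arbitrary continuous probabilistic source, $$\mathbf E\,S=\sum_{w}p_w\,L\!\left(\left|\frac{\alpha-\mu_w}{p_w}\right|\right)$$ (as an equality in $[0,\infty]$, with no tameness or finiteness assumption), where the sum is over all finite prefixes $w\in\Sigma^*$ with $p_w>0$.
   Context: Source. Let $\Sigma$ be a totally ordered alphabet, either $\{0,\dots,r-1\}$ for some finite $r$ or the set of nonnegative integers, with the natural order. $\Sigma^\infty$ is the set of infinite words, with lexicographic order, and $\Sigma^*=\bigcup_{0\le k<\infty}\Sigma^k$ is the set of finite prefixes (including the empty one). Let $M:(0,1)\to\Sigma^\infty$ be a strictly monotone (strictly increasing) measurable map; keys are the words $M(U)$ with uniform$(0,1)$ seeds $U$. For $u\ne t$, $\beta_{\mathrm{symb}}(u,t):=1+{}$(length of the longest common prefix of $M(u)$ and $M(t)$), the number of symbol comparisons needed to compare $M(u)$ and $M(t)$. For $w\in\Sigma^*$, the set of seeds $u\in(0,1)$ for which $M(u)$ begins with $w$ is (up to endpoints) an interval $(a_w,b_w)$; let $p_w:=b_w-a_w$ and $\mu_w:=(a_w+b_w)/2$ (prefixes for which this interval is empty or degenerate have $p_w=0$). The function $L$. For $y\ge0$ write $y^+:=\tfrac12+y$, $y^-:=\tfrac12-y$, with $0\ln0:=0$, and $$H(y):=\begin{cases}-(y^+\ln y^++y^-\ln y^-),&0\le y\le 1/2,\\ y^-(\ln y^+-\ln|y^-|),&y\ge1/2,\end{cases}\qquad L(y):=2[1+H(y)].$$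 The random variable $S$. Fix $\alpha\in[0,1]$ and let $U_1,U_2,\dots$ be i.i.d. uniform$(0,1)$. Put $L_0:=0$, $R_0:=1$ and, inductively for $k\ge 1$, $$\tau_k:=\inf\{i:\ L_{k-1}<U_i<R_{k-1}\},$$ $$L_k:=\mathbf 1(U_{\tau_k}<\alpha)\,U_{\tau_k}+\mathbf 1(U_{\tau_k}>\alpha)\,L_{k-1},\qquad R_k:=\mathbf 1(U_{\tau_k}<\alpha)\,R_{k-1}+\mathbf 1(U_{\tau_k}>\alpha)\,U_{\tau_k},$$ $$I_k:=\int_{L_{k-1}}^{R_{k-1}}\beta_{\mathrm{symb}}(u,U_{\tau_k})\,du,\qquad S:=\sum_{k\ge1}I_k .$$ (The random variables $L_k$ are unrelated to the function $L$.) *)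

(* Defs.v *)
From mathcomp Require Import all_boot all_order all_algebra.
From mathcomp Require Import all_classical all_reals all_analysis.

Set Implicit Arguments.
Unset Strict Implicit.
Unset Printing Implicit Defensive.

Import Order.TTheory GRing.Theory Num.Theory.

Local Open Scope classical_set_scope.
Local Open Scope ring_scope.

(** * Words *)

(* Letters are natural numbers; `I_r is the set {0, ..., r-1}. *)
Definition is_alphabet (Sigma : set nat) : Prop :=
  Sigma = setT \/ exists r : nat, Sigma = `I_r.

Definition infinite_word : Type := nat -> nat.

Definition infinite_words (Sigma : set nat) : set infinite_word :=
  [set x | forall i, Sigma (x i)].

Definition finite_words (Sigma : set nat) : set (seq nat) :=
  [set w | forall a, a \in w -> Sigma a].

Definition has_prefix (w : seq nat) (x : infinite_word) : bool :=
  mkseq x (size w) == w.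

Definition lex_lt (x y : infinite_word) : Prop :=
  exists2 k : nat, (forall i, (i < k)%N -> x i = y i) & (x k < y k)%N.

Definition cylinder (w : seq nat) : set infinite_word :=
  [set x | has_prefix w x].

(* Infinite words with the product sigma-algebra (each factor nat being
   discrete), which is generated by the cylinders. *)
Definition word_space := g_sigma_algebraType (range cylinder).

(** * Probabilistic sources *)

Section Source.
Variable R : realType.

(* M is a map on the open interval (0, 1); its values elsewhere are junk. *)
Record is_source (Sigma : set nat) (M : R -> infinite_word) : Prop := IsSource {
  source_alphabet : is_alphabet Sigma ;
  source_letters : forall u : R, u \in `]0, 1[ -> infinite_words Sigma (M u) ;
  source_increasing : forall u t : R, u \in `]0, 1[ -> t \in `]0, 1[ -> u < t ->
    lex_lt (M u) (M t) ;
  source_measurable : measurable_fun (`]0, 1[ : set R) (M : R -> word_space) }.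

(* Equal to +oo on equal words. *)
Definition lcp (x y : infinite_word) : \bar R :=
  ereal_sup [set n%:R%:E | n in [set n : nat | mkseq x n = mkseq y n]].

Definition beta_symb (M : R -> infinite_word) (u t : R) : \bar R :=
  (1 + lcp (M u) (M t))%E.

Variable M : R -> infinite_word.

Definition seeds (w : seq nat) : set R :=
  [set u | (u \in `]0, 1[) /\ has_prefix w (M u)].

(* The library has inf set0 = sup set0 = 0, so that prefix_prob w = 0 when no
   seed has prefix w. *)
Definition prefix_left (w : seq nat) : R := inf (seeds w).
Definition prefix_right (w : seq nat) : R := sup (seeds w).
Definition prefix_prob (w : seq nat) : R := prefix_right w - prefix_left w.
Definition prefix_mid (w : seq nat) : R :=
  (prefix_left w + prefix_right w) / 2.

End Source.

(** * The function L *)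

Section CostFunction.
Variable R : realType.

(* Meant for y >= 0. The library has ln 0 = 0, and 0 * ln 0 = 0. *)
Definition cost_H (y : R) : R :=
  let yp := 2^-1 + y in
  let ym := 2^-1 - y in
  if y <= 2^-1 then - (yp * ln yp + ym * ln ym)
  else ym * (ln yp - ln `|ym|).

Definition cost_L (y : R) : R := 2 * (1 + cost_H y).

End CostFunction.

(** * The random variable S, as a function of the sequence of seeds *)

Section Search.
Variables (R : realType) (M : R -> infinite_word) (alpha : R).

(* The seeds U_1, U_2, ... are indexed from 0 here. *)
Variable u : nat -> R.

(* The infimum of the i such that u i is in the open interval with endpoints
   lr.1 and lr.2. If there is no such i (for independent uniform seeds and the
   intervals below, an event of probability 0), the value is arbitrarily 0. *)
Definition first_hit (lr : R * R) : nat :=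
  if pselect (exists i, lr.1 < u i < lr.2) is left h then ex_minn h else 0%N.

(* The pair (L_k, R_k). *)
Fixpoint search_interval (k : nat) : R * R :=
  if k is k'.+1 then
    let lr := search_interval k' in
    let p := u (first_hit lr) in
    ((p < alpha)%R%:R * p + (alpha < p)%R%:R * lr.1,
     (p < alpha)%R%:R * lr.2 + (alpha < p)%R%:R * p)
  else (0, 1).

(* tau_k, for k >= 1. *)
Definition tau (k : nat) : nat := first_hit (search_interval k.-1).

(* I_k, for k >= 1. *)
Definition step_cost (k : nat) : \bar R :=
  (\int[lebesgue_measure]_(v in
      [set` `](search_interval k.-1).1, (search_interval k.-1).2[ ])
    beta_symb M v (u (tau k)))%E.

Definition search_cost : \bar R := (\sum_(1 <= k <oo) step_cost k)%E.

End Search.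

(** * Independent uniform seeds *)

Section Seeds.
Context d (Omega : measurableType d) (R : realType) (P : probability Omega R).

Definition mutually_independent (U : nat -> {RV P >-> R}) : Prop :=
  forall (s : seq nat) (A : nat -> set R),
    uniq s -> (forall i, measurable (A i)) ->
    P (\bigcap_(i in [set` s]) (U i @^-1` A i))
      = (\prod_(i <- s) P (U i @^-1` A i))%E.

Definition iid_uniform01 (U : nat -> {RV P >-> R}) : Prop :=
  mutually_independent U /\
  forall (i : nat) (A : set R), measurable A ->
    distribution P (U i) A = uniform_prob (@ltr01 R) A.

End Seeds.

(* Main.v *)
From HB Require Import structures.
Require Import Defs.
From mathcomp Require Import all_boot all_order all_algebra.
From mathcomp Require Import all_classical all_reals all_analysis.
From mathcomp Require Import measurable_realfun lra.

(** Counting the common prefixes of M(v) and M(t) turns beta(v, t) into a sum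
    over the words w. A seed U_i is some pivot tau_k with v in (L_{k-1}, R_{k-1})
    exactly when no earlier seed falls in the convex hull of alpha, v and U_i;
    given U_i = t, this has probability (1 - h)^(i - 1), where h = h(v, t) is the
    length of the hull. Summing the geometric series over i,
    E S = sum_w \int\int_{I_w x I_w} dv dt / h(v, t), with I_w the set of seeds
    of w, and this double integral is p_w L(|alpha - mu_w| / p_w).

    "Exactly when" fails if an earlier seed hits the boundary of the hull. Reading
    the hull as a closed (resp. open) interval gives a lower (resp. upper) bound
    of S along almost every path, and both bounds have the same expectation. This
    also spares proving that S is measurable. *)

Set Implicit Arguments.
Unset Strict Implicit.
Unset Printing Implicit Defensive.

Import Order.TTheory GRing.Theory Num.Theory.
Import numFieldNormedType.Exports.
Local Open Scope classical_set_scope.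
Local Open Scope ring_scope.

(** * Integrals and sums of nonnegative functions *)

(** One hull of three points decides whether v and U_i meet because the search interval always has
    alpha in its closure, and each of its endpoints other than 0 and 1 is an earlier pivot lying on
    its own side of alpha.

    Every summand and integrand is nonnegative, so Tonelli allows all exchanges in [0, +oo] and no
    finiteness is ever required. The only obstruction to the geometric series is h = 0, which forces
    v = t = alpha.

    The shape of L comes from the geometry of the square I_w x I_w. If alpha lies inside I_w (y at
    most 1/2), pairs on the same side of alpha contribute the term 1 of L, and pairs on opposite
    sides contribute the logarithms, hence the entropy. If alpha lies outside, h is the distance
    from alpha to the farther of v and t, which gives the other branch of H. The factor 2 is the
    symmetry in v and t. *)

(** The integral of a nonnegative function is a supremum over the simple functions below it, hence
    monotone whether or not the functions are measurable. *)
Lemma ge0_le_integralW d (T : measurableType d) (R : realType)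
    (mu : {measure set T -> \bar R}) (D : set T) (f g : T -> \bar R) :
  (forall x, D x -> 0 <= f x)%E -> (forall x, D x -> f x <= g x)%E ->
  (\int[mu]_(x in D) f x <= \int[mu]_(x in D) g x)%E.
Proof.
move=> f0 fg.
have g0 x : D x -> (0 <= g x)%E by move=> Dx; exact: le_trans (f0 _ Dx) (fg _ Dx).
rewrite !ge0_integralE//; apply: ge_ereal_sup => _ [h /= hf <-].
apply: ereal_sup_ubound; exists h => //= x.
by apply: le_trans (hf x) _; exact: lee_restrict.
Qed.

Import HBNNSimple.

(** A simple function below f keeps its integral when set to 0 on the exceptional null set, and then
    it lies below g everywhere. Only simple functions have to be measurable here. *)
Lemma ae_ge0_le_integralW d (T : measurableType d) (R : realType)
    (mu : {measure set T -> \bar R}) (f g : T -> \bar R) :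
  (forall x, 0 <= f x)%E -> (forall x, 0 <= g x)%E ->
  {ae mu, forall x, (f x <= g x)%E} ->
  (\int[mu]_x f x <= \int[mu]_x g x)%E.
Proof.
move=> f0 g0 [N [mN N0 fgN]].
rewrite ge0_integralTE//; apply: ge_ereal_sup => _ [h /= hf <-].
rewrite -integralT_nnsfun (ge0_negligible_integral mN)//; last 2 first.
- exact/measurable_EFinP.
- by move=> x _; rewrite lee_fin.
rewrite integral_mkcond; apply: ge0_le_integralW => x _.
  by apply: erestrict_ge0 => y _; rewrite lee_fin.
rewrite patchE; case: ifPn => [|_]; last exact: g0.
rewrite inE setTD => /= xN; apply: le_trans (hf x) _.
by apply: contrapT => fg; apply: xN; exact: fgN.
Qed.

(** Bridge to series over nat, for which monotone convergence is stated: [pickle_inv] lists I along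
    nat, with term 0 at the numbers that code nothing. *)
Lemma esum_countE (R : realType) (I : countType) (a : I -> \bar R) :
  (forall i, 0 <= a i)%E ->
  (\esum_(i in [set: I]) a i = \sum_(n <oo) oapp a 0 (pickle_inv n))%E.
Proof.
move=> a0.
have b0 n : (0 <= oapp a 0 (pickle_inv n : option I))%E by case: pickle_inv => //=.
rewrite nneseries_esumT//.
transitivity (\esum_(n in pickle @` [set: I]) oapp a 0 (pickle_inv n))%E.
  rewrite esum_image; last by move=> i j _ _; exact: (pcan_inj (@pickleK I)).
  by apply: eq_esum => i _; rewrite pickleK_inv.
rewrite esum_mkcond; apply: eq_esum => n _; case: ifPn => //.
rewrite notin_setE => nI; case E : pickle_inv => [i|//]; exfalso; apply: nI.
by exists i => //; have := @pickle_invK I n; rewrite /ocancel E.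
Qed.

Lemma integral_esum d (T : measurableType d) (R : realType)
    (mu : {measure set T -> \bar R}) (D : set T) (I : countType)
    (f : I -> T -> \bar R) : measurable D ->
  (forall i, measurable_fun D (f i)) -> (forall i x, 0 <= f i x)%E ->
  (\int[mu]_(x in D) (\esum_(i in [set: I]) f i x) =
   \esum_(i in [set: I]) (\int[mu]_(x in D) f i x))%E.
Proof.
move=> mD mf f0.
rewrite esum_countE; last by move=> i; exact: integral_ge0.
under eq_integral do rewrite esum_countE//.
pose g n x := oapp (f^~ x) 0%E (pickle_inv n : option I).
rewrite (@integral_nneseries _ _ _ mu D mD g).
- by apply: eq_eseriesr => n _; rewrite /g; case: pickle_inv => //=; rewrite integral0.
- by move=> n; rewrite /g; case: pickle_inv => /=.
- by move=> n x _; rewrite /g; case: pickle_inv => /=.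
Qed.

Lemma measurable_esum d (T : measurableType d) (R : realType) (D : set T)
    (I : countType) (f : I -> T -> \bar R) :
  (forall i, measurable_fun D (f i)) -> (forall i x, 0 <= f i x)%E ->
  measurable_fun D (fun x => \esum_(i in [set: I]) f i x)%E.
Proof.
move=> mf f0.
under eq_fun do rewrite esum_countE//.
apply: ge0_emeasurable_sum => [n x _ _|n _]; case: pickle_inv => //=.
Qed.

Lemma exchange_esum (R : realType) (I J : choiceType) (a : I -> J -> \bar R) :
  (forall i j, 0 <= a i j)%E ->
  (\esum_(i in [set: I]) (\esum_(j in [set: J]) a i j) =
   \esum_(j in [set: J]) (\esum_(i in [set: I]) a i j))%E.
Proof.
move=> a0; rewrite !esum_esum//.
rewrite (@reindex_esum _ _ _ ([set: J] `*`` fun=> [set: I]) _ (fun p => (p.2, p.1)))//.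
split; [by []|by move=> [a1 b1] [a2 b2] _ _ [-> ->]|].
by move=> [i j] _; exists (j, i).
Qed.

Lemma ge0_subset_integralW d (T : measurableType d) (R : realType)
    (mu : {measure set T -> \bar R}) (A B : set T) (f : T -> \bar R) :
  (forall x, B x -> 0 <= f x)%E -> A `<=` B ->
  (\int[mu]_(x in A) f x <= \int[mu]_(x in B) f x)%E.
Proof.
move=> f0 AB; rewrite [leLHS]integral_mkcond [leRHS]integral_mkcond.
have fA0 x : A x -> (0 <= f x)%E by move=> /AB; exact: f0.
apply: ge0_le_integralW => x _; first exact: erestrict_ge0.
rewrite !patchE; case: ifPn => [|_]; first by rewrite inE => /AB/mem_set ->.
by case: ifPn => //; rewrite inE; exact: f0.
Qed.

Lemma le_esum_inj (R : realType) (I J : choiceType) (e : I -> J)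
    (a : I -> \bar R) (b : J -> \bar R) :
  injective e -> (forall j, 0 <= b j)%E -> (forall i, a i <= b (e i))%E ->
  (\esum_(i in [set: I]) a i <= \esum_(j in [set: J]) b j)%E.
Proof.
move=> inj_e b0 ab; apply: (@le_trans _ _ (\esum_(i in [set: I]) b (e i))%E).
  exact: le_esum.
rewrite -(@esum_image _ _ _ setT e b); last by move=> i j _ _; exact: inj_e.
by rewrite esum_mkcond; apply: le_esum => j _; case: ifP.
Qed.

Lemma esum_supp_image (R : realType) (I J : choiceType) (e : I -> J)
    (b : J -> \bar R) :
  injective e -> (forall j, ~ range e j -> b j = 0%E) ->
  (\esum_(j in [set: J]) b j = \esum_(i in [set: I]) b (e i))%E.
Proof.
move=> inj_e b0.
rewrite -(@esum_image _ _ _ setT e b); last by move=> i j _ _; exact: inj_e.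
rewrite [RHS]esum_mkcond; apply: eq_esum => j _; case: ifPn => //.
by rewrite notin_setE; exact: b0.
Qed.

(** * Independence of a variable and its predecessors *)

Section Independence.
Context d d' (Omega : measurableType d) (T : measurableType d').
Variables (R : realType) (P : probability Omega R).
Variables (U : nat -> {mfun Omega >-> T}) (n : nat).

(** Events that constrain [U 0, ..., U n.-1] separately: a pi-system on which independence is a
    product formula. *)
Definition past_events : set (set Omega) :=
  [set B | exists2 A : nat -> set T, (forall j, measurable (A j)) &
    B = \bigcap_(j in `I_n) (U j @^-1` A j)].

(* A substitute for the space of the vectors (U 0, ..., U n.-1), for which no
   n-fold product measure is needed. *)
Definition past_space := g_sigma_algebraType past_events.

Lemma past_events_setI : setI_closed past_events.
Proof.
move=> _ _ [A mA ->] [B mB ->]; exists (fun j => A j `&` B j).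
  by move=> j; exact: measurableI.
by rewrite -bigcapI; apply: eq_bigcapr => j _; rewrite preimage_setI.
Qed.

Lemma past_events_setT : past_events setT.
Proof.
by exists (fun=> setT) => //; apply/seteqP; split.
Qed.

Lemma measurable_past (B : set Omega) : <<s past_events >> B -> measurable B.
Proof.
apply: smallest_sub; first exact: sigma_algebra_measurable.
move=> _ [A mA ->]; apply: bigcap_measurableType => j _.
by rewrite -[X in measurable X]setTI; exact: measurable_funP.
Qed.

Lemma measurable_fun_past :
  measurable_fun [set: Omega] (id : Omega -> past_space).
Proof. by move=> _ B mB; rewrite setTI; exact: measurable_past. Qed.

Lemma measurable_fun_past_RV j : (j < n)%N ->
  measurable_fun [set: past_space] (U j : past_space -> T).
Proof.
move=> jn _ B mB; rewrite setTI; apply: sub_sigma_algebra.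
exists (fun k => if k == j then B else setT); first by move=> k; case: ifP.
apply/seteqP; split=> [w Bw k _ /=|w /(_ j jn)/=]; last by rewrite eqxx.
by case: eqP => [->|].
Qed.

Definition to_past : Omega -> past_space := id.

HB.instance Definition _ :=
  isMeasurableFun.Build _ _ _ _ to_past measurable_fun_past.

Hypothesis indep : forall (s : seq nat) (A : nat -> set T),
  uniq s -> (forall i, measurable (A i)) ->
  P (\bigcap_(i in [set` s]) (U i @^-1` A i)) =
    (\prod_(i <- s) P (U i @^-1` A i))%E.

(** As functions of B, both sides are finite measures, P restricted to an event and P scaled by a
    constant; they agree on the pi-system [past_events]. *)
Lemma past_independent (A : set T) (B : set Omega) :
  measurable A -> <<s past_events >> B ->
  P (U n @^-1` A `&` B) = (P (U n @^-1` A) * P B)%E.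
Proof.
move=> mA mB.
have mUA : measurable (U n @^-1` A).
  by rewrite -[X in measurable X]setTI; exact: measurable_funP.
pose p : {nonneg R} := NngNum (fine_ge0 (measure_ge0 P (U n @^-1` A))).
have pE : P (U n @^-1` A) = (p%:num)%:E by rewrite /= fineK// fin_num_measure.
rewrite setIC pE -[LHS]/(mrestr P mUA B) -[RHS]/(mscale p P B).
apply: (g_sigma_algebra_measure_unique past_events _ (fun=> setT)) => //.
- by move=> C GC; apply: measurable_past; exact: sub_sigma_algebra.
- by move=> k; exact: past_events_setT.
- by rewrite bigcup_const.
- exact: past_events_setI.
- move=> _ [C mC ->].
  transitivity (P (U n @^-1` A) * P (\bigcap_(j in `I_n) (U j @^-1` C j)))%E;
    last by rewrite pE.
  rewrite -[LHS]/(P (_ `&` (U n @^-1` A))) setIC.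
  (* [C'] prescribes A at time n and C before, so that independence can be applied to the indices n,
     0, ..., n.-1 and again without n. *)
  pose C' j := if j == n then A else C j.
  have mC' j : measurable (C' j) by rewrite /C'; case: ifP.
  have C'E j : (j < n)%N -> C' j = C j by rewrite /C' => /ltn_eqF ->.
  have := @indep (n :: iota 0 n) C'.
  rewrite /= iota_uniq mem_iota add0n ltnn andbF => /(_ isT mC').
  rewrite big_cons {2}/C' eqxx => E.
  have := @indep (iota 0 n) C' (iota_uniq _ _) mC'.
  have -> : \bigcap_(i in [set` iota 0 n]) (U i @^-1` C' i) =
            \bigcap_(j in `I_n) (U j @^-1` C j).
    apply/seteqP; split=> w Cw j /=.
      by move=> jn; have := Cw j; rewrite /= mem_iota C'E//; exact.
    by rewrite mem_iota => jn; rewrite C'E//; exact: Cw.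
  move=> ->; rewrite -E; congr (P _).
  apply/seteqP; split=> [w [Aw Cw] j /=|w Cw].
    rewrite inE => /orP[/eqP ->|]; first by rewrite /C' eqxx.
    by rewrite mem_iota => jn; rewrite C'E//; exact: Cw.
  split; first by have := Cw n; rewrite /= mem_head /C' eqxx; exact.
  move=> j /= jn; have := Cw j; rewrite /= in_cons mem_iota jn orbT C'E//; exact.
- by move=> k; rewrite -[X in (X < _)%E]/(P (_ `&` (U n @^-1` A))) setTI ltey_eq fin_num_measure.
Qed.

Definition now_past (w : Omega) : T * past_space := (U n w, to_past w).

Lemma measurable_fun_now_past : measurable_fun [set: Omega] now_past.
Proof. by apply: measurable_fun_pair => //; exact: measurable_fun_past. Qed.

HB.instance Definition _ :=
  isMeasurableFun.Build _ _ _ _ now_past measurable_fun_now_past.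

Lemma distribution_now_past (X : set (T * past_space)) : measurable X ->
  distribution P now_past X =
  (distribution P (U n) \x distribution P to_past)%E X.
Proof.
move=> mX; symmetry; apply: product_measure_unique => // A B mA mB.
exact: past_independent.
Qed.

(** The pair of [U n] and its past has a product law, so one integrates over the value t of [U n];
    for fixed t, the earlier variables fall independently into the section of D at t. *)
Lemma iid_first_avoid (D : set (T * T)) (A : set T) (mu : probability T R) :
  (forall i B, measurable B -> distribution P (U i) B = mu B) ->
  measurable D -> measurable A ->
  (P [set w | A (U n w) /\ forall j, (j < n)%N -> D (U n w, U j w)] =
   \int[mu]_(t in A) (mu (xsection D t) ^+ n))%E.
Proof.
move=> law mD mA.
pose X : set (T * past_space) :=
  [set p | A p.1 /\ forall j, (j < n)%N -> D (p.1, U j (p.2 : Omega))].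
have mX : measurable X.
  have -> : X = (fst @^-1` A) `&`
      \bigcap_(j in `I_n) ((fun p : T * past_space => (p.1, U j (p.2 : Omega))) @^-1` D).
    by apply/seteqP; split=> p [].
  apply: measurableI.
    by rewrite -[X in measurable X]setTI; exact: measurable_fst.
  apply: bigcap_measurableType => j jn; rewrite -[X in measurable X]setTI.
  have mj : measurable_fun [set: T * past_space]
      (fun p : T * past_space => (p.1, U j (p.2 : Omega))).
    apply: measurable_fun_pair; first exact: measurable_fst.
    apply: (@measurableT_comp _ _ _ _ past_space T (U j : past_space -> T)).
      exact: measurable_fun_past_RV.
    exact: measurable_snd.
  exact: mj.
rewrite -[LHS]/(distribution P now_past X) distribution_now_past//.
rewrite /product_measure1/= (eq_measure_integral mu); last by move=> B mB _; exact: law.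
rewrite [RHS]integral_mkcond; apply: eq_integral => t _ /=; rewrite patchE.
have [tA|tA] := boolP (t \in A); last first.
  rewrite [xsection _ _](_ : _ = set0) ?measure0//.
  apply/seteqP; split=> // w; rewrite /xsection/= inE => -[/= At _].
  by move: tA; rewrite notin_setE.
have -> : xsection X t = \bigcap_(j in `I_n) (U j @^-1` (xsection D t)).
  apply/seteqP; split=> w; rewrite /xsection/= inE.
    by move=> [_ H] j jn /=; rewrite inE; exact: H.
  move=> H; split=> /=; first exact: set_mem.
  by move=> j jn; have := H j jn; rewrite /= inE.
have mDt := measurable_xsection t mD.
have := @indep (iota 0 n) (fun=> xsection D t) (iota_uniq _ _) (fun=> mDt).
have -> : \bigcap_(j in [set` iota 0 n]) (U j @^-1` xsection D t) =
          \bigcap_(j in `I_n) (U j @^-1` xsection D t).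
  by congr (bigcap _ _); apply/seteqP; split=> j /=; rewrite mem_iota.
move=> ->.
under eq_bigr do rewrite -[P _]/(distribution P (U _) _) law//.
by rewrite big_const_seq count_predT size_iota iter_mule mule1.
Qed.

End Independence.

(** * The search path *)

Section Search.
Variables (R : realType) (alpha : R).
Hypothesis alpha01 : 0 <= alpha <= 1.

Definition hull_left (v t : R) : R := Order.min alpha (Order.min v t).
Definition hull_right (v t : R) : R := Order.max alpha (Order.max v t).

(* Of alpha, v and t: the closed hull for b = true, its interior for b = false. *)
Definition hull (b : bool) (v t : R) : interval R :=
  Interval (BSide b (hull_left v t)) (BSide (~~ b) (hull_right v t)).

Definition avoids (b : bool) (u : nat -> R) (v : R) (i : nat) : Prop :=
  forall j, (j < i)%N -> u j \notin hull b v (u i).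

Variable u : nat -> R.
Hypothesis u01 : forall i, 0 < u i < 1.

Local Notation lr := (search_interval alpha u).
Local Notation hit k := (first_hit u (lr k)).

Lemma first_hitP (ab : R * R) (i : nat) : ab.1 < u i < ab.2 ->
  [/\ ab.1 < u (first_hit u ab) < ab.2, (first_hit u ab <= i)%N &
      forall j, (j < first_hit u ab)%N -> ~~ (ab.1 < u j < ab.2)].
Proof.
move=> ui; rewrite /first_hit; case: pselect => [h|[]]; last by exists i.
case: ex_minnP => m um min_m; split=> //; first exact: min_m.
by move=> j jm; apply/negP => /min_m; rewrite leqNgt jm.
Qed.

Lemma search_intervalS k :
  (u (hit k) < alpha -> lr k.+1 = (u (hit k), (lr k).2)) *
  (alpha < u (hit k) -> lr k.+1 = ((lr k).1, u (hit k))).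
Proof.
split=> /= h; rewrite h (lt_gtF h) !mul1r !mul0r ?addr0 ?add0r//.
Qed.

(* n is one more than the index of the last hit. *)
Definition search_inv (k : nat) (n : nat) : Prop :=
  [/\ (lr k).1 <= alpha <= (lr k).2,
      (forall j, (j < n)%N -> ~~ ((lr k).1 < u j < (lr k).2)),
      (lr k).1 = 0 \/ (exists2 j, (j < n)%N & (lr k).1 = u j /\ u j < alpha) &
      (lr k).2 = 1 \/ (exists2 j, (j < n)%N & (lr k).2 = u j /\ alpha < u j)].

Lemma search_inv0 : search_inv 0 0.
Proof. by split=> //=; left. Qed.

Lemma search_invS k n : search_inv k n -> (lr k).1 < u (hit k) < (lr k).2 ->
  u (hit k) != alpha -> (forall j, (j < hit k)%N -> ~~ ((lr k).1 < u j < (lr k).2)) ->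
  (n <= hit k)%N /\ search_inv k.+1 (hit k).+1.
Proof.
move=> [/andP[la ar] out El Er] uk uka mink.
have nk : (n <= hit k)%N by rewrite leqNgt; apply/negP => /out; rewrite uk.
split=> //; have /andP[lu ur] := uk; move: uka; rewrite neq_lt => /orP[ua|au].
- rewrite /search_inv (search_intervalS k).1//=; split.
  + by rewrite (ltW ua) ar.
  + move=> j; rewrite ltnS leq_eqVlt => /predU1P[->|jk]; first by rewrite ltxx.
    apply: contra (mink j jk) => /andP[h1 ->]; by rewrite (lt_trans lu h1).
  + by right; exists (hit k).
  + case: Er => [->|[j jn H]]; [by left|right; exists j => //].
    by rewrite ltnS; apply: leq_trans nk; exact: ltnW.
- rewrite /search_inv (search_intervalS k).2//=; split.
  + by rewrite (ltW au) la.
  + move=> j; rewrite ltnS leq_eqVlt => /predU1P[->|jk]; first by rewrite ltxx andbF.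
    apply: contra (mink j jk) => /andP[-> h1]; by rewrite (lt_trans h1 ur).
  + case: El => [->|[j jn H]]; [by left|right; exists j => //].
    by rewrite ltnS; apply: leq_trans nk; exact: ltnW.
  + by right; exists (hit k).
Qed.

Lemma hull_minmax v t : [/\ hull_left v t <= alpha, hull_left v t <= v, hull_left v t <= t &
  [/\ alpha <= hull_right v t, v <= hull_right v t & t <= hull_right v t]].
Proof. by rewrite /hull_left /hull_right !ge_min !le_max !lexx !orbT. Qed.

(** An endpoint other than 0 and 1 is an earlier seed on its own side of alpha. Since it avoids the
    closed hull, it lies beyond the hull on that side, so v and [u i] are strictly inside. *)
Lemma search_inv_mem k n i v : search_inv k n -> (n <= i)%N ->
  avoids true u v i -> 0 < v < 1 ->
  ((lr k).1 < v < (lr k).2) /\ ((lr k).1 < u i < (lr k).2).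
Proof.
move=> [/andP[la ar] _ El Er] ni av /andP[v0 v1].
have [ml mv mu [al vl ul]] := hull_minmax v (u i).
have /andP[u0 u1] := u01 i.
have out j : (j < n)%N -> (u j < hull_left v (u i)) || (hull_right v (u i) < u j).
  move=> jn; have := av j (leq_trans jn ni).
  by rewrite in_itv/= negb_and -!ltNge.
have [lv lu] : (lr k).1 < v /\ (lr k).1 < u i.
  case: El => [->//|[j jn [-> uja]]].
  have := out j jn; rewrite (le_gtF (le_trans (ltW uja) al)) orbF => h.
  by split; apply: lt_le_trans h _.
have [vr ur] : v < (lr k).2 /\ u i < (lr k).2.
  case: Er => [->//|[j jn [-> uja]]].
  have := out j jn; rewrite (le_gtF (le_trans ml (ltW uja))) /= => h.
  by split; apply: le_lt_trans h.
by rewrite lv lu vr ur.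
Qed.

Lemma avoids_hit (v : R) (i : nat) : avoids true u v i -> 0 < v < 1 ->
  exists k, hit k = i /\ (lr k).1 < v < (lr k).2.
Proof.
move=> av v01.
(* m is fuel: every hit before i raises n, while n stays at most i. *)
suff H m : forall k n, (i < m + n)%N -> (n <= i)%N -> search_inv k n ->
    exists k, hit k = i /\ (lr k).1 < v < (lr k).2.
  apply: (H i.+1 0%N 0%N) => //; first by rewrite addn0.
  exact: search_inv0.
elim: m => [|m IH] k n inm ni inv; first by move: inm; rewrite add0n ltnNge ni.
have [vk uik] := search_inv_mem inv ni av v01.
have [uk ki mink] := first_hitP uik.
have [hki|hki] := eqVneq (hit k) i; first by exists k.
have {}ki : (hit k < i)%N by rewrite ltn_neqAle hki ki.
(* A pivot equal to alpha would reset the interval to (0, 0). None precedes i, because alpha belongs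
   to the closed hull. *)
have ua : u (hit k) != alpha.
  apply/eqP => E; have := av _ ki; rewrite E in_itv/=.
  by have [-> _ _ [-> _ _]] := hull_minmax v (u i).
have [nk inv'] := search_invS inv uk ua mink.
apply: (IH k.+1 (hit k).+1) => //; apply: leq_trans inm _.
by rewrite addSn addnS ltnS leq_add2l.
Qed.

Hypothesis u_alpha : forall i, u i != alpha.
Hypothesis u_dense : forall a b, 0 <= a -> b <= 1 -> a < b -> exists i, a < u i < b.

(** Density puts a seed in every search interval, so [first_hit] never returns its default 0; since
    seeds differ from alpha, no step collapses the interval to (0, 0). *)
Lemma search_interval_bounds k : [/\ 0 <= (lr k).1, (lr k).1 < (lr k).2 & (lr k).2 <= 1].
Proof.
elim: k => [|k [l0 lr r1]]; first by rewrite /= ltr01 !lexx.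
have [i /first_hitP[uk _ _]] := u_dense l0 r1 lr.
have /andP[lu ur] := uk; have := u_alpha (hit k); rewrite neq_lt => /orP[ua|au].
- by rewrite (search_intervalS k).1//=; split=> //; apply: le_trans l0 (ltW _).
- by rewrite (search_intervalS k).2//=; split=> //; apply: le_trans (ltW _) r1.
Qed.

Lemma hitP k : [/\ (lr k).1 < u (hit k) < (lr k).2 &
  forall j, (j < hit k)%N -> ~~ ((lr k).1 < u j < (lr k).2)].
Proof.
have [l0 lr r1] := search_interval_bounds k.
by have [i /first_hitP[uk _ mink]] := u_dense l0 r1 lr.
Qed.

Lemma search_inv_ex k : exists2 n, search_inv k n & (n <= hit k)%N.
Proof.
elim: k => [|k [n inv nk]]; first by exists 0%N => //; exact: search_inv0.
have [uk mink] := hitP k.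
have [_ inv'] := search_invS inv uk (u_alpha _) mink.
exists (hit k).+1 => //.
have [uk1 mink1] := hitP k.+1.
by have [] := search_invS inv' uk1 (u_alpha _) mink1.
Qed.

Lemma hit_lt k : (hit k < hit k.+1)%N.
Proof.
have [n inv _] := search_inv_ex k.
have [uk mink] := hitP k.
have [_ inv'] := search_invS inv uk (u_alpha _) mink.
have [uk1 mink1] := hitP k.+1.
by have [] := search_invS inv' uk1 (u_alpha _) mink1.
Qed.

(** Different steps have different pivots, so a sum over steps embeds in a sum over seeds. *)
Lemma hit_inj : injective (fun k => hit k).
Proof.
move=> j k; have mono : {mono (fun k => hit k) : m n / (m <= n)%N}.
  by apply: leq_mono; apply: homo_ltn => [? ? ?|]; [exact: ltn_trans|exact: hit_lt].
by move=> E; apply/eqP; rewrite eqn_leq -(mono j k) -(mono k j) E leqnn.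
Qed.

(** The search interval is convex, contains v and the pivot, and has alpha in its closure; it
    therefore contains the open hull, and the seeds before the pivot miss the interval. *)
Lemma hit_avoids k v : (lr k).1 < v < (lr k).2 -> avoids false u v (hit k).
Proof.
move=> /andP[lv vr] j jk.
have [n [/andP[la ar] _ _ _] _] := search_inv_ex k.
have [/andP[lu ur] mink] := hitP k.
apply: contra (mink j jk); rewrite in_itv/= => /andP[h1 h2]; apply/andP; split.
  by apply: le_lt_trans h1; rewrite /hull_left !le_min la (ltW lv) (ltW lu).
by apply: lt_le_trans h2 _; rewrite /hull_right !ge_max ar (ltW vr) (ltW ur).
Qed.

End Search.

(** * Words and prefixes *)

Lemma has_prefixP (w : seq nat) (x : infinite_word) :
  reflect (forall i, (i < size w)%N -> x i = nth 0%N w i) (has_prefix w x).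
Proof.
apply: (iffP eqP) => [<- i|H].
  by rewrite size_mkseq => iw; rewrite nth_mkseq.
apply: (@eq_from_nth _ 0%N); first by rewrite size_mkseq.
by move=> i; rewrite size_mkseq => iw; rewrite nth_mkseq// H.
Qed.

(** A first disagreement of z with x or y inside w would put z strictly above, or strictly below, a
    letter that x and y share. *)
Lemma has_prefix_between (w : seq nat) (x y z : infinite_word) :
  lex_lt x z -> lex_lt z y -> has_prefix w x -> has_prefix w y -> has_prefix w z.
Proof.
move=> [k xz xzk] [l zy zyl] /has_prefixP wx /has_prefixP wy.
apply/has_prefixP => i iw.
have [ik|ki] := ltnP i k; first by rewrite -xz// wx.
have kw : (k < size w)%N := leq_ltn_trans ki iw.
have [kl|lk|lk] := ltngtP k l.
- by move: xzk; rewrite (zy _ kl) wx// wy// ltnn.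
- by move: zyl; rewrite -(xz _ lk) wx ?wy ?(ltn_trans lk)// ltnn.
- move: xzk zyl; rewrite -lk wx// wy// => h1 h2.
  by have := ltn_trans h1 h2; rewrite ltnn.
Qed.

(** The lengths of common prefixes form the initial segment from 0 to the longest one, the 1 being
    due to the empty prefix; for equal words they fill nat and both sides are +oo. *)
Lemma esum_1_lcp (R : realType) (x y : infinite_word) :
  (\esum_(n in [set n | mkseq x n = mkseq y n]) 1 = 1 + lcp R x y)%E.
Proof.
rewrite /lcp; set E := [set n | _].
have card n : (\esum_(i in `I_n) 1 = n%:R%:E :> \bar R)%E.
  rewrite esum_fset//.
  rewrite -fsbig_ord sumEFin.
  by rewrite big_const card_ord iter_addr addr0.
have downE m n : (m <= n)%N -> E n -> E m.
  move=> mn /= E_; have := congr1 (take m) E_.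
  by rewrite -!map_take !take_iota (minn_idPl mn).
have [[n0 n0E]|allE] := pselect (exists n, ~ E n).
  have nE : exists n, `[< ~ E n >] by exists n0; exact/asboolP.
  have [m mE] : exists m, E = `I_m.+1.
    case: (ex_minnP nE) => -[|m] /asboolP mE minm; first by case: mE.
    exists m; apply/seteqP; split=> n /= nm.
      by rewrite ltnNge; apply/negP => /downE/(_ nm).
    apply: contrapT => nE'; have : (m.+1 <= n)%N by apply: minm; exact/asboolP.
    by rewrite leqNgt nm.
  rewrite mE card -natr1 EFinD addeC; congr (_ + _)%E.
  apply/eqP; rewrite eq_le; apply/andP; split.
    by apply: ereal_sup_ubound; exists m => //=.
  apply: ge_ereal_sup => _ [n /= nm <-].
  by rewrite lee_fin ler_nat -ltnS.
have {allE}-> : E = setT.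
  by apply/seteqP; split=> // n _; apply: contrapT => nE; apply: allE; exists n.
have pinf (z : \bar R) : (forall n : nat, n%:R%:E <= z)%E -> z = +oo%E.
  move=> nz; apply/eqyP => A A0; apply: le_trans (nz (Num.trunc A).+1).
  by rewrite lee_fin ltW// truncnS_gt.
rewrite [LHS]pinf; last first.
  move=> n; rewrite -card; rewrite esum_mkcond; apply: le_esum => i _.
  by case: ifP; rewrite ?lee_fin.
rewrite [X in (1 + X)%E]pinf//.
by move=> n; apply: ereal_sup_ubound; exists n.
Qed.

(** * Seeds of a prefix, and bounds of the cost along one path *)

Section Source.
Variables (R : realType) (Sigma : set nat) (M : R -> infinite_word).
Hypothesis hM : is_source Sigma M.

Lemma seeds_interval (w : seq nat) : is_interval (seeds M w).
Proof.
move=> a b [a01 wa] [b01 wb] c /andP[ac cb].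
have c01 : c \in `]0, 1[.
  move: a01 b01; rewrite !in_itv/= => /andP[a0 _] /andP[_ b1].
  by rewrite (lt_le_trans a0 ac) (le_lt_trans cb b1).
split=> //; move: ac; rewrite le_eqVlt => /predU1P[<-//|ac].
move: cb; rewrite le_eqVlt => /predU1P[->//|cb].
exact: (has_prefix_between (source_increasing hM a01 c01 ac)
  (source_increasing hM c01 b01 cb)).
Qed.

Lemma measurable_seeds (w : seq nat) : measurable (seeds M w).
Proof. by apply: is_interval_measurable; exact: seeds_interval. Qed.

(** For each length n the only candidate word is the prefix of [M v] of that length, so the sum over
    words is a sum over lengths. *)
Lemma beta_symb_esum (v t : R) : v \in `]0, 1[ -> t \in `]0, 1[ ->
  (beta_symb M v t =
   \esum_(w in [set: seq nat]) (\1_[set x | seeds M w x /\ seeds M w t] v)%:E)%E.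
Proof.
move=> v01 t01; rewrite /beta_symb -esum_1_lcp.
rewrite (@esum_supp_image _ _ _ (mkseq (M v))).
- rewrite esum_mkcond; apply: eq_esum => n _; rewrite indicE.
  have -> : (n \in [set n | mkseq (M v) n = mkseq (M t) n]) =
      (v \in [set x | seeds M (mkseq (M v) n) x /\ seeds M (mkseq (M v) n) t]).
    apply/idP/idP; rewrite !inE/=; [move=> E|move=> [_ [_]]].
      by rewrite /seeds/= /has_prefix !size_mkseq E eqxx.
    by rewrite /has_prefix size_mkseq => /eqP.
  by case: ifP.
- by move=> m n /(congr1 size); rewrite !size_mkseq.
- move=> w nw; rewrite indicE memNset//= => -[[_ wv] _]; apply: nw.
  by exists (size w) => //; exact/eqP.
Qed.

Variable alpha : R.
Hypothesis alpha01 : 0 <= alpha <= 1.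

(** Its measure is the share of the word w in the cost charged to seed i; [b = true] and [b = false]
    yield the lower and the upper bound of S. *)
Definition common_region (b : bool) (u : nat -> R) (i : nat) (w : seq nat) : set R :=
  [set v | (seeds M w v /\ seeds M w (u i)) /\ avoids alpha b u v i].

Lemma measurable_notin_hull d (T : measurableType d) (b : bool) (f g h : T -> R) :
  measurable_fun setT f -> measurable_fun setT g -> measurable_fun setT h ->
  measurable [set x | h x \notin hull alpha b (f x) (g x)].
Proof.
move=> mf mg mh.
have ml : measurable_fun setT (fun x => hull_left alpha (f x) (g x)).
  by apply: measurable_minr => //; exact: measurable_minr.
have mr : measurable_fun setT (fun x => hull_right alpha (f x) (g x)).
  by apply: measurable_maxr => //; exact: measurable_maxr.
rewrite -[X in measurable X]setTI.
have mb : measurable_fun setT (fun x => h x \notin hull alpha b (f x) (g x)).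
  apply: measurable_neg; rewrite /hull; under eq_fun do rewrite in_itv/=.
  by case: b => /=; apply: measurable_and;
    do ?[exact: measurable_fun_ler|exact: measurable_fun_ltr].
exact: mb.
Qed.

Lemma measurable_avoids (b : bool) (u : nat -> R) (i : nat) :
  measurable [set v | avoids alpha b u v i].
Proof.
have -> : [set v | avoids alpha b u v i] =
    \bigcap_(j in `I_i) [set v | u j \notin hull alpha b v (u i)] by [].
apply: bigcap_measurableType => j _.
by apply: (@measurable_notin_hull _ _ b id (cst (u i)) (cst (u j))).
Qed.

Section Path.
Variable u : nat -> R.
Hypothesis u01 : forall i, 0 < u i < 1.

Let region b i := [set v | (v \in `]0, 1[) /\ avoids alpha b u v i].

Lemma integral_beta_region b i :
  (\int[lebesgue_measure]_(v in region b i) beta_symb M v (u i) =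
   \esum_(w in [set: seq nat]) lebesgue_measure (common_region b u i w))%E.
Proof.
have mreg : measurable (region b i).
  by apply: measurableI; [exact: measurable_itv|exact: measurable_avoids].
under eq_integral.
  move=> v; rewrite inE => -[v01 _]; rewrite beta_symb_esum//; last by rewrite in_itv/= u01.
  over.
have mB w : measurable [set x | seeds M w x /\ seeds M w (u i)].
  have [ui|ui] := pselect (seeds M w (u i)).
    rewrite [X in measurable X](_ : _ = seeds M w); first exact: measurable_seeds.
    by apply/seteqP; split=> x // [].
  by rewrite [X in measurable X](_ : _ = set0)//; apply/seteqP; split=> x // [].
rewrite integral_esum//; last first.
  by move=> w; apply/measurable_EFinP/measurable_indic; exact: mB.
apply: eq_esum => w _; rewrite integral_indic; [|exact: mreg|exact: mB]; congr (lebesgue_measure _).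
apply/seteqP; split=> v /=; first by move=> [wv [_ av]].
by move=> [[wv wu] av]; split=> //; split=> //; case: wv.
Qed.

Lemma beta_symb_ge0 v t : (0 <= beta_symb M v t)%E.
Proof.
apply: adde_ge0 => //; apply: ereal_sup_ubound.
by exists 0%N.
Qed.

Hypothesis u_alpha : forall i, u i != alpha.
Hypothesis u_dense : forall a b, 0 <= a -> b <= 1 -> a < b -> exists i, a < u i < b.

Lemma search_cost_esum :
  search_cost M alpha u = (\esum_(k in [set: nat]) step_cost M alpha u k.+1)%E.
Proof.
have s0 k : (0 <= step_cost M alpha u k)%E.
  by apply: integral_ge0 => v _; exact: beta_symb_ge0.
rewrite /search_cost -(nneseries_addn 1 s0) nneseries_esumT; last first.
  by move=> n; exact: s0.
by apply: eq_esum => k _; rewrite addn1.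
Qed.

Lemma search_cost_bounds :
  (\esum_(i in [set: nat]) \esum_(w in [set: seq nat])
      lebesgue_measure (common_region true u i w) <= search_cost M alpha u)%E /\
  (search_cost M alpha u <= \esum_(i in [set: nat]) \esum_(w in [set: seq nat])
      lebesgue_measure (common_region false u i w))%E.
Proof.
pose hit k := first_hit u (search_interval alpha u k).
have hitI : injective hit := hit_inj alpha01 u_alpha u_dense.
have c0 b i : (0 <= \int[lebesgue_measure]_(v in region b i) beta_symb M v (u i))%E.
  by apply: integral_ge0 => v _; exact: beta_symb_ge0.
rewrite search_cost_esum; split.
  under eq_esum do rewrite -integral_beta_region.
  (* A seed that is never a pivot has an empty closed-hull region, by [avoids_hit]; only the indices
     [hit k] remain. *)
  rewrite (esum_supp_image hitI); last first.
    move=> i ni; rewrite [region _ _](_ : _ = set0) ?integral_set0//.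
    apply/seteqP; split=> // v [v01 /avoids_hit].
    move=> /(_ alpha01 u01); rewrite in_itv/= in v01 => /(_ v01) [k [ki _]].
    by apply: ni; exists k.
  apply: le_esum => k _; apply: ge0_subset_integralW.
    by move=> v _; exact: beta_symb_ge0.
  move=> v [v01 /avoids_hit]; rewrite in_itv/= in v01.
  (* Injectivity of [hit] identifies the step j produced by [avoids_hit] with k. *)
  move=> /(_ alpha01 u01 v01) [j [/hitI <- jv]].
  by rewrite /= in_itv.
under [leRHS]eq_esum do rewrite -integral_beta_region.
apply: (le_esum_inj hitI) => // k; apply: ge0_subset_integralW.
  by move=> v _; exact: beta_symb_ge0.
move=> v /=; rewrite in_itv/= => kv; split; last first.
  exact: (hit_avoids alpha01 u_alpha u_dense).
have [l0 _ r1] := search_interval_bounds u_alpha u_dense k.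
by rewrite in_itv/=; case/andP: kv => lv vr; rewrite (le_lt_trans l0 lv) (lt_le_trans vr r1).
Qed.

End Path.
End Source.

(** * Integrals over the plane *)

Lemma measurable_set_pred d (T : measurableType d) (p : T -> bool) :
  measurable_fun setT p -> measurable [set x | p x].
Proof. by move=> mp; rewrite -[X in measurable X]setTI; exact: mp. Qed.

Section PlaneIntegral.
Variable R : realType.
Local Notation mu := (@lebesgue_measure R).
Implicit Types (f : R * R -> \bar R) (E : set (R * R)) (A : set R) (B : R -> set R).

Lemma plane_integral_x f E A B : measurable_fun setT f -> (forall z, 0 <= f z)%E ->
  measurable E -> (forall v t, E (v, t) <-> A v /\ B v t) ->
  (\int[mu \x mu]_(z in E) f z = \int[mu]_(v in A) (\int[mu]_(t in B v) f (v, t)))%E.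
Proof.
move=> mf f0 mE EAB; rewrite integral_mkcond fubini_tonelli1; last 2 first.
- by apply/(measurable_restrictT _ mE); exact: measurable_funTS.
- by move=> z; exact: erestrict_ge0.
rewrite [RHS]integral_mkcond; apply: eq_integral => v _; rewrite /fubini_F patchE.
case: ifPn => vA.
  rewrite [RHS]integral_mkcond; apply: eq_integral => t _; rewrite !patchE.
  congr (if _ then _ else _); apply/idP/idP; rewrite !inE; first by move/EAB => [].
  by move=> Bt; apply/EAB; split=> //; exact: set_mem.
apply: integral0_eq => t _; rewrite patchE memNset// => /EAB[Av _].
by move: vA; rewrite notin_setE.
Qed.

Lemma plane_integral_y f E A B : measurable_fun setT f -> (forall z, 0 <= f z)%E ->
  measurable E -> (forall v t, E (v, t) <-> A t /\ B t v) ->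
  (\int[mu \x mu]_(z in E) f z = \int[mu]_(t in A) (\int[mu]_(v in B t) f (v, t)))%E.
Proof.
move=> mf f0 mE EAB; rewrite integral_mkcond fubini_tonelli2; last 2 first.
- by apply/(measurable_restrictT _ mE); exact: measurable_funTS.
- by move=> z; exact: erestrict_ge0.
rewrite [RHS]integral_mkcond; apply: eq_integral => v _; rewrite /fubini_G patchE.
case: ifPn => vA.
  rewrite [RHS]integral_mkcond; apply: eq_integral => t _; rewrite !patchE.
  congr (if _ then _ else _); apply/idP/idP; rewrite !inE; first by move/EAB => [].
  by move=> Bt; apply/EAB; split=> //; exact: set_mem.
apply: integral0_eq => t _; rewrite patchE memNset// => /EAB[Av _].
by move: vA; rewrite notin_setE.
Qed.

(** Cuts the region along the zero set of g, in use always a line through (alpha, alpha). *)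
Lemma plane_integral_split f E (g : R * R -> R) :
  measurable_fun setT f -> (forall z, 0 <= f z)%E -> measurable E ->
  measurable_fun setT g -> (mu \x mu)%E [set z | g z = 0] = 0%E ->
  (\int[mu \x mu]_(z in E) f z =
   \int[mu \x mu]_(z in E `&` [set z | 0 < g z]%R) f z +
   \int[mu \x mu]_(z in E `&` [set z | g z < 0]%R) f z)%E.
Proof.
move=> mf f0 mE mg g0.
have m0 : measurable [set z | g z = 0].
  rewrite -[X in measurable X]setTI.
  exact: (mg measurableT [set 0] (measurable_set1 0)).
have mp : measurable [set z | 0 < g z].
  by apply: measurable_set_pred; exact: measurable_fun_ltr.
have mn : measurable [set z | g z < 0].
  by apply: measurable_set_pred; exact: measurable_fun_ltr.
rewrite -ge0_integral_setU//=; last 4 first.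
- exact: measurableI.
- exact: measurableI.
- exact: measurable_funTS.
- apply/disj_setPS => z [[_ /= h1] [_ /= h2]].
  by have := lt_trans h1 h2; rewrite ltxx.
rewrite (@ge0_negligible_integral _ _ R (mu \x mu)%E E _ f m0)//; last exact: measurable_funTS.
rewrite -setIUr [in LHS](_ : E `\` _ = E `&` ([set z | 0 < g z] `|` [set z | g z < 0]))//.
apply/seteqP; split=> z /= [Ez h]; split=> //.
  by apply/orP; rewrite orbC -neq_lt; exact/eqP.
by case: h => h E0; move: h; rewrite E0 ltxx.
Qed.

Lemma null_sections (g : R * R -> R) : measurable_fun setT g ->
  (forall v, exists t0, forall t, g (v, t) = 0 -> t = t0) ->
  (mu \x mu)%E [set z | g z = 0] = 0%E.
Proof.
move=> mg gv; rewrite /product_measure1/= integral0_eq// => v _ /=.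
have [t0 ht0] := gv v.
apply: (@subset_measure0 _ _ _ mu _ [set t0]).
- apply: measurable_xsection; rewrite -[X in measurable X]setTI.
  exact: (mg measurableT [set 0] (measurable_set1 0)).
- exact: measurable_set1.
- by move=> t; rewrite /xsection/= inE; exact: ht0.
- exact: lebesgue_measure_set1.
Qed.

(** A vertical line escapes [null_sections], its one nonempty section being all of R; as a product
    its measure is 0 * +oo = 0. *)
Lemma null_vertical_line (c : R) :
  (mu \x mu)%E [set z : R * R | z.1 - c = 0] = 0%E.
Proof.
rewrite (_ : [set _ | _] = [set c] `*` setT); last first.
  apply/seteqP; split=> -[x y] /=; first by move/eqP; rewrite subr_eq0 => /eqP.
  by move=> [-> _]; rewrite subrr.
by rewrite product_measure1E//= lebesgue_measure_set1 mul0e.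
Qed.

Lemma plane_integral_sym f E E' : measurable_fun setT f -> (forall z, 0 <= f z)%E ->
  (forall v t, f (v, t) = f (t, v)) -> measurable E -> measurable E' ->
  (forall v t, E (v, t) <-> E' (t, v)) ->
  (\int[mu \x mu]_(z in E) f z = \int[mu \x mu]_(z in E') f z)%E.
Proof.
move=> mf f0 fs mE mE' EE'.
rewrite (@plane_integral_x _ _ setT (fun v t => E (v, t)))//; last by split=> // -[].
rewrite (@plane_integral_y _ E' setT (fun v t => E (v, t)))//; last first.
  by move=> v t; split=> [/EE'//|[_ /EE']].
by apply: eq_integral => v _; apply: eq_integral => t _; exact: fs.
Qed.

(** * One-dimensional integrals *)

Lemma integral_itv_cst (c d k : R) : c <= d ->
  (\int[mu]_(x in `]c, d[) k%:E = (k * (d - c))%:E)%E.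
Proof.
move=> cd; rewrite integral_cst//= lebesgue_measure_itv/= lte_fin.
by case: ltgtP cd => [cd _|//|-> _]; rewrite ?subrr ?mulr0 ?mule0 ?EFinM ?EFinB.
Qed.

(** A general slope s lets one antiderivative serve both for a pole to the left of the interval (s =
    1) and for a pole to its right (s = -1). *)
Lemma integral_inv_affine (s t c d : R) : s != 0 -> c <= d ->
  (forall x, c <= x <= d -> 0 < s * (x - t)) ->
  (\int[mu]_(x in `]c, d[) ((s * (x - t))^-1)%:E =
   (s^-1 * (ln (s * (d - t)) - ln (s * (c - t))))%:E)%E.
Proof.
move=> s0; rewrite le_eqVlt => /predU1P[<- _|cd pos].
  by rewrite set_itvoo0 integral_set0 subrr mulr0.
pose F := fun y : R => s^-1 *: ln (s *: (y - t)).
have cf : {within `[c, d], continuous (fun x : R => (s * (x - t))^-1)}.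
  apply: continuous_in_subspaceT => x; rewrite inE/= in_itv/= => xcd.
  apply: cvgV; first by rewrite gt_eqF// pos.
  by apply: cvgM; [exact: cvg_cst|apply: cvgB; [exact: cvg_id|exact: cvg_cst]].
have dF x : c <= x <= d -> is_derive x 1 F (s * (x - t))^-1.
  move=> xcd.
  have dB : is_derive x (1 : R) (fun y : R => s *: (y - t)) s.
    have d1 : is_derive x (1 : R) (fun y : R => y - t) 1.
      by rewrite -[X in is_derive _ _ _ X]subr0; apply: is_deriveB.
    by have := is_deriveZ s d1; rewrite [s *: 1]mulr1; exact.
  have := is_derive1_comp (f := @ln R) (g := fun y => s *: (y - t))
    (is_derive1_ln (pos _ xcd)) dB.
  move=> /(@is_deriveZ _ _ _ _ s^-1); rewrite [X in is_derive _ _ _ X]mulrC mulfK//.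
have cF x : c <= x <= d -> {for x, continuous F}.
  move=> xcd; apply: differentiable_continuous; apply/derivable1_diffP.
  by have [] := dF _ xcd.
have := @continuous_FTC2 _ (fun x : R => (s * (x - t))^-1) F c d cd cf.
rewrite -EFinB /F -scalerBr => <-//.
- rewrite -(@integral_itv_bndoo _ c d _ true false)//.
  apply/measurable_EFinP; apply: measurable_funS (subspace_continuous_measurable_fun _ cf) => //.
  exact: subset_itv_oo_cc.
- split.
  + move=> x; rewrite in_itv/= => /andP[/ltW cx /ltW xd].
    by have [] := dF x; rewrite ?cx.
  + by apply: cvg_at_right_filter; apply: cF; rewrite lexx ltW.
  + by apply: cvg_at_left_filter; apply: cF; rewrite lexx ltW.
- move=> x; rewrite in_itv/= => /andP[/ltW cx /ltW xd].
  by rewrite derive1E; have [|_ ->//] := dF x; rewrite cx.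
Qed.

Lemma integral_inv_sub (c d t : R) : t < c -> c <= d ->
  (\int[mu]_(x in `]c, d[) ((x - t)^-1)%:E = (ln (d - t) - ln (c - t))%:E)%E.
Proof.
move=> tc cd; under eq_integral do rewrite -[_ - t]mul1r.
rewrite integral_inv_affine ?oner_eq0//; first by rewrite invr1 !mul1r.
by move=> x /andP[cx _]; rewrite mul1r subr_gt0 (lt_le_trans tc).
Qed.

Lemma integral_inv_rsub (c d t : R) : d < t -> c <= d ->
  (\int[mu]_(x in `]c, d[) ((t - x)^-1)%:E = (ln (t - c) - ln (t - d))%:E)%E.
Proof.
move=> td cd; under eq_integral do rewrite -opprB -mulN1r.
rewrite integral_inv_affine ?oppr_eq0 ?oner_eq0//.
  by rewrite invrN1 !mulN1r !opprB.
by move=> x /andP[_ xd]; rewrite mulN1r opprB subr_gt0 (le_lt_trans xd).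
Qed.

(** The inverse is total, with value 0 at 0, and not continuous there. Squaring makes the base
    nonnegative, where [powR] with exponent -1 is the inverse, and x / x^2 = 1 / x holds at 0 as
    well. *)
Lemma measurable_inv : measurable_fun [set: R] (@GRing.inv R).
Proof.
rewrite (_ : @GRing.inv R = fun x => (x ^+ 2) `^ (-1) * x).
  apply: measurable_funM => //.
  apply: (measurableT_comp (f := fun x : R => x `^ (-1))); last exact: measurable_funX.
  exact: measurable_powR.
apply/funext => x; rewrite powR_inv1 ?sqr_ge0//.
have [->|x0] := eqVneq x 0; first by rewrite invr0 mulr0.
by rewrite expr2 invfM -mulrA mulVf// mulr1.
Qed.

(* At alpha = a, the junk value ln 0 is multiplied by 0. *)
Lemma integral_ratio_left (alpha a b : R) : alpha <= a -> a < b ->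
  (\int[mu]_(x in `]a, b[) ((x - a) / (x - alpha))%:E =
   ((b - a) - (a - alpha) * (ln (b - alpha) - ln (a - alpha)))%:E)%E.
Proof.
rewrite le_eqVlt => /predU1P[->|aa] ab.
  under eq_integral => x.
    rewrite inE/= in_itv/= => /andP[ax _].
    by rewrite divff ?subr_eq0 ?gt_eqF//; over.
  by rewrite integral_itv_cst ?ltW// mul1r subrr mul0r subr0.
have k0 : 0 <= a - alpha by rewrite subr_ge0 ltW.
have pos x : x \in `]a, b[%classic -> 0 < x - alpha.
  by rewrite inE/= in_itv/= => /andP[ax _]; rewrite subr_gt0 (lt_trans aa).
have mi D : measurable_fun D (fun x : R => ((x - alpha)^-1)%:E).
  apply/measurable_EFinP; apply: measurable_funTS.
  by apply: measurableT_comp; [exact: measurable_inv|exact: measurable_funB].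
have Y : (\int[mu]_(x in `]a, b[) ((a - alpha)%:E * ((x - alpha)^-1)%:E) =
    ((a - alpha) * (ln (b - alpha) - ln (a - alpha)))%:E)%E.
  rewrite ge0_integralZl_EFin//; first by rewrite integral_inv_sub// ltW.
    by move=> x xab; rewrite lee_fin invr_ge0 ltW// pos// inE.
  exact: mi.
(* 1 = (x - a) / (x - alpha) + (a - alpha) / (x - alpha) with both terms nonnegative: the integral
   is found by cancelling in a sum, never by integrating a difference. *)
rewrite EFinB -Y -[in RHS](mul1r (b - a)) -integral_itv_cst ?ltW//.
have -> : (\int[mu]_(x in `]a, b[) 1%:E = \int[mu]_(x in `]a, b[)
   (((x - a) / (x - alpha))%:E + (a - alpha)%:E * ((x - alpha)^-1)%:E))%E.
  apply: eq_integral => x /pos x0; rewrite -EFinM -EFinD -mulrDl.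
  by rewrite addrA subrK divff ?gt_eqF.
rewrite ge0_integralD//=; last 4 first.
- move=> x; rewrite in_itv/= => /andP[ax _]; rewrite lee_fin divr_ge0 ?subr_ge0 ?ltW//.
  exact: lt_trans ax.
- apply/measurable_EFinP/measurable_funM; first exact: measurable_funB.
  by apply: measurableT_comp; [exact: measurable_inv|exact: measurable_funB].
- by move=> x xab; rewrite mule_ge0 ?lee_fin// invr_ge0 ltW// pos// inE.
- by apply: emeasurable_funM => //; exact: mi.
by rewrite addeK// Y.
Qed.

Lemma integral_ratio_right (alpha a b : R) : b <= alpha -> a < b ->
  (\int[mu]_(x in `]a, b[) ((b - x) / (alpha - x))%:E =
   ((b - a) - (alpha - b) * (ln (alpha - a) - ln (alpha - b)))%:E)%E.
Proof.
rewrite le_eqVlt => /predU1P[<-|aa] ab.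
  under eq_integral => x.
    rewrite inE/= in_itv/= => /andP[_ xb].
    by rewrite divff ?subr_eq0 ?gt_eqF//; over.
  by rewrite integral_itv_cst ?ltW// mul1r subrr mul0r subr0.
have k0 : 0 <= alpha - b by rewrite subr_ge0 ltW.
have pos x : x \in `]a, b[%classic -> 0 < alpha - x.
  by rewrite inE/= in_itv/= => /andP[_ xb]; rewrite subr_gt0 (lt_trans xb).
have mi D : measurable_fun D (fun x : R => ((alpha - x)^-1)%:E).
  apply/measurable_EFinP; apply: measurable_funTS.
  by apply: measurableT_comp; [exact: measurable_inv|exact: measurable_funB].
have Y : (\int[mu]_(x in `]a, b[) ((alpha - b)%:E * ((alpha - x)^-1)%:E) =
    ((alpha - b) * (ln (alpha - a) - ln (alpha - b)))%:E)%E.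
  rewrite ge0_integralZl_EFin//; first by rewrite integral_inv_rsub// ltW.
    by move=> x xab; rewrite lee_fin invr_ge0 ltW// pos// inE.
  exact: mi.
rewrite EFinB -Y -[in RHS](mul1r (b - a)) -integral_itv_cst ?ltW//.
have -> : (\int[mu]_(x in `]a, b[) 1%:E = \int[mu]_(x in `]a, b[)
   (((b - x) / (alpha - x))%:E + (alpha - b)%:E * ((alpha - x)^-1)%:E))%E.
  apply: eq_integral => x /pos x0; rewrite -EFinM -EFinD -mulrDl.
  by rewrite addrC addrA subrK divff ?gt_eqF.
rewrite ge0_integralD//=; last 4 first.
- move=> x; rewrite in_itv/= => /andP[_ xb]; rewrite lee_fin divr_ge0 ?subr_ge0 ?ltW//.
  exact: lt_trans aa.
- apply/measurable_EFinP/measurable_funM; first exact: measurable_funB.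
  by apply: measurableT_comp; [exact: measurable_inv|exact: measurable_funB].
- by move=> x xab; rewrite mule_ge0 ?lee_fin// invr_ge0 ltW// pos// inE.
- by apply: emeasurable_funM => //; exact: mi.
by rewrite addeK// Y.
Qed.

End PlaneIntegral.

(** * The integral of the inverse hull length *)

Section HullIntegral.
Variables (R : realType) (alpha : R).
Local Notation mu := (@lebesgue_measure R).

Definition hull_width (v t : R) : R := hull_right alpha v t - hull_left alpha v t.

Lemma hull_width_ge0 v t : 0 <= hull_width v t.
Proof.
have [la _ _ [ar _ _]] := hull_minmax alpha v t.
by rewrite subr_ge0 (le_trans la ar).
Qed.

Lemma hull_widthC v t : hull_width v t = hull_width t v.
Proof. by rewrite /hull_width /hull_right /hull_left maxC minC (maxC v) (minC v) maxC minC. Qed.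

Lemma hull_width_left v t : alpha <= t -> t <= v -> hull_width v t = v - alpha.
Proof.
move=> at_ tv; have av := le_trans at_ tv.
by rewrite /hull_width /hull_right /hull_left (max_l tv) (max_r av) (min_r tv) (min_l at_).
Qed.

Lemma hull_width_right v t : t <= v -> v <= alpha -> hull_width v t = alpha - t.
Proof.
move=> tv va; have ta := le_trans tv va.
by rewrite /hull_width /hull_right /hull_left (max_l tv) (max_l va) (min_r tv) (min_r ta).
Qed.

Lemma hull_width_mid v t : t <= alpha -> alpha <= v -> hull_width v t = v - t.
Proof.
move=> ta av; have tv := le_trans ta av.
by rewrite /hull_width /hull_right /hull_left (max_l tv) (max_r av) (min_r tv) (min_r ta).
Qed.

Lemma measurable_hull_width d (T : measurableType d) (f g : T -> R) :
  measurable_fun setT f -> measurable_fun setT g ->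
  measurable_fun setT (fun x => hull_width (f x) (g x)).
Proof.
move=> mf mg; apply: measurable_funB.
  by apply: measurable_maxr => //; exact: measurable_maxr.
by apply: measurable_minr => //; exact: measurable_minr.
Qed.

Let f (z : R * R) : \bar R := ((hull_width z.1 z.2)^-1)%:E.

Let mf : measurable_fun [set: R * R] f.
Proof.
apply/measurable_EFinP; apply: measurableT_comp; first exact: measurable_inv.
by apply: measurable_hull_width; [exact: measurable_fst|exact: measurable_snd].
Qed.

Let f0 z : (0 <= f z)%E.
Proof. by rewrite lee_fin invr_ge0 hull_width_ge0. Qed.

Let mfst : measurable_fun [set: R * R] fst := measurable_fst.
Let msnd : measurable_fun [set: R * R] snd := measurable_snd.

Definition triangle (a b : R) : set (R * R) :=
  [set z | [&& a < z.2, z.2 < z.1 & z.1 < b]].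

Lemma measurable_triangle a b : measurable (triangle a b).
Proof.
by apply: measurable_set_pred; do !apply: measurable_and; exact: measurable_fun_ltr.
Qed.

(** The width is symmetric in v and t and the diagonal is null, so both halves of the square weigh
    the same. *)
Lemma hull_integral_triangle a b :
  (\int[mu]_(v in `]a, b[) (\int[mu]_(t in `]a, b[) ((hull_width v t)^-1)%:E) =
   2%:E * \int[mu \x mu]_(z in triangle a b) f z)%E.
Proof.
have mI : measurable (`]a, b[ : set R) by exact: measurable_itv.
rewrite -(@plane_integral_x R f (`]a, b[%classic `*` `]a, b[%classic))//; last first.
  exact: measurableX.
have mg : measurable_fun [set: R * R] (fun z => z.1 - z.2) by exact: measurable_funB.
rewrite (plane_integral_split mf f0 _ mg); last 2 first.
- exact: measurableX.
- by apply: null_sections => // v; exists v => t /= /eqP; rewrite subr_eq0 => /eqP.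
have mSn : measurable ((`]a, b[%classic `*` `]a, b[%classic) `&`
    [set z : R * R | z.1 - z.2 < 0]).
  apply: measurableI; first exact: measurableX.
  by apply: measurable_set_pred; exact: measurable_fun_ltr.
have mT := measurable_triangle a b.
have fs v t : f (v, t) = f (t, v) by rewrite /f/= hull_widthC.
have E1 : ((`]a, b[%classic `*` `]a, b[%classic) `&`
    [set z : R * R | 0 < z.1 - z.2]) = triangle a b.
  apply/seteqP; split=> -[v t] /=; rewrite !in_itv/= subr_gt0.
    by move=> [[/andP[av vb] /andP[at_ tb]] tv]; apply/and3P.
  move=> /and3P[at_ tv vb]; rewrite at_ tv vb (lt_trans at_ tv) (lt_trans tv vb).
  by [].
rewrite E1 [X in (_ + X)%E](plane_integral_sym mf f0 fs mSn mT); last first.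
  move=> v t; split=> /=; rewrite !in_itv/= subr_lt0.
    by move=> [[/andP[av vb] /andP[at_ tb]] tv]; apply/and3P.
  by move=> /and3P[av vt tb]; rewrite av vt tb (lt_trans av vt) (lt_trans vt tb).
by rewrite -mule2n mule_natl.
Qed.

(** On this side of alpha the width v - alpha does not depend on t, which is therefore integrated
    first. In the mirror case the width is alpha - t and v is integrated first. *)
Lemma triangle_integral_left a b : alpha <= a -> a < b ->
  (\int[mu \x mu]_(z in triangle a b) f z =
   ((b - a) - (a - alpha) * (ln (b - alpha) - ln (a - alpha)))%:E)%E.
Proof.
move=> aa ab; rewrite -integral_ratio_left//.
rewrite (@plane_integral_x _ f _ `]a, b[%classic (fun v => `]a, v[%classic))//; last 2 first.
- exact: measurable_triangle.
- move=> v t; rewrite /triangle/= !in_itv/=; split.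
    by move=> /and3P[at_ tv vb]; rewrite (lt_trans at_ tv) vb at_ tv.
  by move=> [/andP[av vb] /andP[at_ tv]]; apply/and3P.
apply: eq_integral => v; rewrite inE/= in_itv/= => /andP[av vb].
transitivity (\int[mu]_(t in `]a, v[) ((v - alpha)^-1)%:E)%E.
  apply: eq_integral => t; rewrite inE/= in_itv/= => /andP[at_ tv].
  by rewrite /f/= hull_width_left ?(ltW tv)// (le_trans aa (ltW at_)).
by rewrite integral_itv_cst ?ltW// mulrC.
Qed.

Lemma triangle_integral_right a b : b <= alpha -> a < b ->
  (\int[mu \x mu]_(z in triangle a b) f z =
   ((b - a) - (alpha - b) * (ln (alpha - a) - ln (alpha - b)))%:E)%E.
Proof.
move=> aa ab; rewrite -integral_ratio_right//.
rewrite (@plane_integral_y _ f _ `]a, b[%classic (fun t => `]t, b[%classic))//; last 2 first.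
- exact: measurable_triangle.
- move=> v t; rewrite /triangle/= !in_itv/=; split.
    by move=> /and3P[at_ tv vb]; rewrite (lt_trans tv vb) vb at_ tv.
  by move=> [/andP[at_ tb] /andP[tv vb]]; apply/and3P.
apply: eq_integral => t; rewrite inE/= in_itv/= => /andP[at_ tb].
transitivity (\int[mu]_(v in `]t, b[) ((alpha - t)^-1)%:E)%E.
  apply: eq_integral => v; rewrite inE/= in_itv/= => /andP[tv vb].
  by rewrite /f/= hull_width_right ?(ltW tv)// (le_trans (ltW vb) aa).
by rewrite integral_itv_cst ?ltW// mulrC.
Qed.

(* The part t < alpha < v is cut along the line through (alpha, alpha) and the
   opposite corner (b, a) of the rectangle: by homogeneity the inner integral
   is constant on either side. *)
Lemma triangle_integral_mid a b : a < alpha -> alpha < b ->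
  (\int[mu \x mu]_(z in triangle a b) f z =
   ((b - a) + (b - alpha) * ln (1 + (alpha - a) / (b - alpha))
            + (alpha - a) * ln (1 + (b - alpha) / (alpha - a)))%:E)%E.
Proof.
move=> aa ab.
have A0 : 0 < alpha - a by rewrite subr_gt0.
have B0 : 0 < b - alpha by rewrite subr_gt0.
set A := alpha - a in A0 *; set B := b - alpha in B0 *.
have mT := measurable_triangle a b.
have mg1 : measurable_fun [set: R * R] (fun z => z.1 - alpha) by exact: measurable_funB.
have mg2 : measurable_fun [set: R * R] (fun z => z.2 - alpha) by exact: measurable_funB.
(* [g3] vanishes on the cut; at v = b its zero is t = a. *)
pose g3 (z : R * R) := A * (z.1 - alpha) - B * (alpha - z.2).
have mg3 : measurable_fun [set: R * R] g3.
  by apply: measurable_funB; apply: measurable_funM => //; exact: measurable_funB.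
have mp (g : R * R -> R) : measurable_fun setT g -> measurable [set z | 0 < g z].
  by move=> mg; apply: measurable_set_pred; exact: measurable_fun_ltr.
have mn (g : R * R -> R) : measurable_fun setT g -> measurable [set z | g z < 0].
  by move=> mg; apply: measurable_set_pred; exact: measurable_fun_ltr.
rewrite (plane_integral_split mf f0 mT mg1 (null_vertical_line alpha)).
have mT1 : measurable (triangle a b `&` [set z | 0 < z.1 - alpha]).
  by apply: measurableI => //; exact: mp.
rewrite (plane_integral_split mf f0 mT1 mg2); last first.
  by apply: null_sections => // v; exists alpha => t /= /eqP; rewrite subr_eq0 => /eqP.
have mT2 : measurable (triangle a b `&` [set z | 0 < z.1 - alpha] `&` [set z | z.2 - alpha < 0]).
  by apply: measurableI => //; exact: mn.
rewrite (plane_integral_split mf f0 mT2 mg3); last first.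
  apply: null_sections => // v; exists (alpha - A / B * (v - alpha)) => t /=.
  rewrite /g3/= => /eqP; rewrite subr_eq0 => /eqP E.
  have -> : A / B * (v - alpha) = alpha - t by rewrite mulrAC E mulrC mulKf// gt_eqF.
  by rewrite opprB addrC subrK.
(* Here alpha < t < v, and the width v - alpha is also the length of the range of t: the inner
   integral is 1. *)
have -> : (\int[mu \x mu]_(z in (triangle a b `&` [set z | 0 < z.1 - alpha]
    `&` [set z | 0 < z.2 - alpha])%R) f z = B%:E)%E.
  rewrite (@plane_integral_x _ f _ `]alpha, b[%classic (fun v => `]alpha, v[%classic))//; last 2 first.
  - by apply: measurableI => //; exact: mp.
  - move=> v t; rewrite /triangle/= !in_itv/= !subr_gt0; split.
      by move=> [[/and3P[at_ tv vb] av] ->]; rewrite av vb tv.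
    move=> [/andP[av vb] /andP[at_ tv]]; split=> //; split=> //.
    by rewrite tv vb (lt_trans aa at_).
  transitivity (\int[mu]_(v in `]alpha, b[) 1%:E)%E; last by rewrite integral_itv_cst ?mul1r// ltW.
  apply: eq_integral => v; rewrite inE/= in_itv/= => /andP[av vb].
  transitivity (\int[mu]_(t in `]alpha, v[) ((v - alpha)^-1)%:E)%E.
    apply: eq_integral => t; rewrite inE/= in_itv/= => /andP[at_ tv].
    by rewrite /f/= hull_width_left// ltW.
  by rewrite integral_itv_cst ?ltW// mulVf// gt_eqF// subr_gt0.
have -> : (\int[mu \x mu]_(z in (triangle a b `&` [set z | z.1 - alpha < 0])%R) f z = A%:E)%E.
  rewrite (@plane_integral_y _ f _ `]a, alpha[%classic (fun t => `]t, alpha[%classic))//; last 2 first.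
  - by apply: measurableI => //; exact: mn.
  - move=> v t; rewrite /triangle/= !in_itv/= !subr_lt0; split.
      by move=> [/and3P[at_ tv vb] av]; rewrite at_ av tv (lt_trans tv av).
    move=> [/andP[at_ ta] /andP[tv va]]; split=> //.
    by rewrite tv at_ (lt_trans va ab).
  transitivity (\int[mu]_(v in `]a, alpha[) 1%:E)%E; last by rewrite integral_itv_cst ?mul1r// ltW.
  apply: eq_integral => t; rewrite inE/= in_itv/= => /andP[at_ ta].
  transitivity (\int[mu]_(v in `]t, alpha[) ((alpha - t)^-1)%:E)%E.
    apply: eq_integral => v; rewrite inE/= in_itv/= => /andP[tv va].
    by rewrite /f/= hull_width_right// ltW.
  by rewrite integral_itv_cst ?ltW// mulVf// gt_eqF// subr_gt0.
have -> : (\int[mu \x mu]_(z in (triangle a b `&` [set z | 0 < z.1 - alpha]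
    `&` [set z | z.2 - alpha < 0] `&` [set z | 0 < g3 z])%R) f z = (B * ln (1 + A / B))%:E)%E.
  rewrite (@plane_integral_x _ f _ `]alpha, b[%classic
    (fun v => `](alpha - A / B * (v - alpha))%R, alpha[%classic))//; last 2 first.
  - by apply: measurableI => //; exact: mp.
  - move=> v t; rewrite /triangle/= !in_itv/= /g3/= !subr_gt0 subr_lt0.
    have -> : (alpha - A / B * (v - alpha) < t) = (B * (alpha - t) < A * (v - alpha)).
      by rewrite ltrBlDl -ltrBlDr mulrAC ltr_pdivlMr// mulrC.
    split; first by move=> [[[/and3P[at_ tv vb] av] ta] g0]; rewrite av vb g0 ta.
    move=> [/andP[av vb] /andP[g0 ta]]; do !split=> //.
    rewrite vb (lt_trans ta av) !andbT.
    (* Above the cut a < t is automatic, since v < b forces alpha - t < A. *)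
    have : B * (alpha - t) < B * A.
      by apply: lt_trans g0 _; rewrite [ltRHS]mulrC ltr_pM2l// ltrD2r.
    by rewrite ltr_pM2l// /A ltrD2l ltrN2.
  transitivity (\int[mu]_(v in `]alpha, b[) (ln (1 + A / B))%:E)%E; last first.
    by rewrite integral_itv_cst ?ltW// mulrC.
  apply: eq_integral => v; rewrite inE/= in_itv/= => /andP[av vb].
  have va : 0 < v - alpha by rewrite subr_gt0.
  have AB0 : 0 < A / B by rewrite divr_gt0.
  transitivity (\int[mu]_(t in `](alpha - A / B * (v - alpha))%R, alpha[) ((v - t)^-1)%:E)%E.
    apply: eq_integral => t; rewrite inE/= in_itv/= => /andP[_ ta].
    by rewrite /f/= hull_width_mid// ltW.
  rewrite integral_inv_rsub//; last by rewrite gerBl mulr_ge0 ?ltW.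
  congr EFin.
  (* The factor v - alpha cancels in the difference of logarithms, which leaves a constant. *)
  have -> : v - (alpha - A / B * (v - alpha)) = (1 + A / B) * (v - alpha).
    by rewrite [RHS]mulrDl mul1r opprB addrCA addrA [RHS]addrC addrA.
  by rewrite lnM ?posrE ?addrK// addr_gt0.
have -> : (\int[mu \x mu]_(z in (triangle a b `&` [set z | 0 < z.1 - alpha]
    `&` [set z | z.2 - alpha < 0] `&` [set z | g3 z < 0])%R) f z = (A * ln (1 + B / A))%:E)%E.
  rewrite (@plane_integral_y _ f _ `]a, alpha[%classic
    (fun t => `]alpha, (alpha + B / A * (alpha - t))%R[%classic))//; last 2 first.
  - by apply: measurableI => //; exact: mn.
  - move=> v t; rewrite /triangle/= !in_itv/= /g3/= !subr_gt0 !subr_lt0.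
    have -> : (v < alpha + B / A * (alpha - t)) = (A * (v - alpha) < B * (alpha - t)).
      by rewrite -ltrBlDl mulrAC ltr_pdivlMr// mulrC.
    split; first by move=> [[[/and3P[at_ tv vb] av] ta] g0]; rewrite av at_ g0 ta.
    move=> [/andP[at_ ta] /andP[av g0]]; do !split=> //.
    rewrite at_ (lt_trans ta av) /=.
    have : A * (v - alpha) < A * B.
      by apply: lt_trans g0 _; rewrite [ltRHS]mulrC ltr_pM2l// ltrD2l ltrN2.
    by rewrite ltr_pM2l// /B ltrD2r.
  transitivity (\int[mu]_(t in `]a, alpha[) (ln (1 + B / A))%:E)%E; last first.
    by rewrite integral_itv_cst ?ltW// mulrC.
  apply: eq_integral => t; rewrite inE/= in_itv/= => /andP[at_ ta].
  have ta0 : 0 < alpha - t by rewrite subr_gt0.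
  have AB0 : 0 < B / A by rewrite divr_gt0.
  transitivity (\int[mu]_(v in `]alpha, (alpha + B / A * (alpha - t))%R[) ((v - t)^-1)%:E)%E.
    apply: eq_integral => v; rewrite inE/= in_itv/= => /andP[av _].
    by rewrite /f/= hull_width_mid// ltW.
  rewrite integral_inv_sub//; last by rewrite lerDl mulr_ge0 ?ltW.
  congr EFin.
  have -> : alpha + B / A * (alpha - t) - t = (1 + B / A) * (alpha - t).
    by rewrite [RHS]mulrDl mul1r addrAC.
  by rewrite lnM ?posrE ?addrK// addr_gt0.
rewrite -!EFinD; congr EFin.
have -> : b - a = A + B by rewrite /A /B; lra.
lra.
Qed.

End HullIntegral.

(** * The cost function *)

Section Cost.
Variable R : realType.
Local Notation mu := (@lebesgue_measure R).

Lemma ln_div_pos (x y : R) : 0 < x -> 0 < y -> ln (x / y) = ln x - ln y.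
Proof. by move=> x0 y0; rewrite lnM ?lnV ?posrE ?invr_gt0. Qed.

(** k is the distance from alpha to an interval of length p; its midpoint is at distance p/2 + k, so
    y = 1/2 + k/p and y^- = -k/p. *)
Lemma cost_L_outside (p k : R) : 0 < p -> 0 <= k ->
  p * cost_L ((p + 2 * k) / (2 * p)) = 2 * (p - k * (ln (p + k) - ln k)).
Proof.
move=> p0 k0; have pn0 : p != 0 by rewrite gt_eqF.
have yE : (p + 2 * k) / (2 * p) = 2^-1 + k / p.
  by rewrite mulrDl invfM mulrCA divff// mulr1 mulrACA divff ?mul1r// pnatr_eq0.
have E : cost_H ((p + 2 * k) / (2 * p)) = - (k / p) * (ln (p + k) - ln k) :> R.
  have pk : 1 + k / p = (p + k) / p by rewrite mulrDl divff.
  have d1 : 2^-1 + (2^-1 + k / p) = (p + k) / p by rewrite -pk; lra.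
  have d2 : 2^-1 - (2^-1 + k / p) = - (k / p) by lra.
  rewrite /cost_H yE gerDl d1 d2 normrN.
  (* k = 0 means y = 1/2, which falls in the first branch of [cost_H], with y^- = 0; its value 0
     agrees with the second formula. *)
  move: k0; rewrite le_eqVlt => /predU1P[<-|k0].
    by rewrite !mul0r lexx addr0 divff// ln1 oppr0 !mul0r mulr0 addr0 oppr0.
  rewrite leNgt divr_gt0//= gtr0_norm ?divr_gt0// !ln_div_pos ?addr_gt0//.
  by rewrite opprB addrA subrK.
rewrite /cost_L E mulrCA; congr (2 * _).
by rewrite mulrDr mulr1 mulNr mulrN mulrA [p * _]mulrC mulfVK.
Qed.

(** A and B are the distances from alpha to the two endpoints. Then y^+ and y^- are A / (A + B) and
    B / (A + B) in some order, and H is the entropy of this two-point distribution. *)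
Lemma cost_L_inside (A B : R) : 0 < A -> 0 < B ->
  (A + B) * cost_L `|(A - B) / (2 * (A + B))| =
  2 * (A + B + B * ln (1 + A / B) + A * ln (1 + B / A)).
Proof.
wlog AB : A B / B <= A.
  move=> H A0 B0; have [/H|/ltW /H] := leP B A; first exact.
  by move=> /(_ B0 A0); rewrite -(opprB A B) mulNr normrN (addrC B A) => ->; rewrite addrAC.
move=> A0 B0; have p0 : 0 < A + B by rewrite addr_gt0.
have pn0 : A + B != 0 by rewrite gt_eqF.
rewrite ger0_norm; last by rewrite divr_ge0 ?subr_ge0// mulr_ge0 ?ltW.
have ypE : 2^-1 + (A - B) / (2 * (A + B)) = A / (A + B).
  apply: (mulIf pn0); rewrite mulfVK// mulrDl invfM mulrA mulfVK//; lra.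
have ymE : 2^-1 - (A - B) / (2 * (A + B)) = B / (A + B).
  apply: (mulIf pn0); rewrite mulfVK// mulrBl invfM mulrA mulfVK//; lra.
rewrite /cost_L /cost_H ypE ymE -subr_ge0 ymE divr_ge0 ?ltW//.
have -> : 1 + A / B = (A + B) / B by rewrite mulrDl divff ?gt_eqF// addrC.
have -> : 1 + B / A = (A + B) / A by rewrite mulrDl divff ?gt_eqF.
rewrite !ln_div_pos// mulrCA; congr (2 * _).
have key x y : (A + B) * (1 - (A / (A + B) * x + B / (A + B) * y)) =
    A + B - (A * x + B * y).
  by rewrite mulrBr mulr1 mulrDr !mulrA ![(A + B) * _ / _]mulrAC !divff// !mul1r.
rewrite key; lra.
Qed.

Lemma hull_integral_cost (alpha a b : R) : a < b ->
  (\int[mu]_(v in `]a, b[) (\int[mu]_(t in `]a, b[) ((hull_width alpha v t)^-1)%:E) =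
   ((b - a) * cost_L `|(alpha - (b + a) / 2) / (b - a)|)%:E)%E.
Proof.
move=> ab; have p0 : 0 < b - a by rewrite subr_gt0.
have pn0 : b - a != 0 by rewrite gt_eqF.
rewrite hull_integral_triangle.
have [aa|aa] := leP alpha a.
  rewrite triangle_integral_left// -EFinM; congr EFin.
  have -> : `|(alpha - (b + a) / 2) / (b - a)| = (b - a + 2 * (a - alpha)) / (2 * (b - a)).
    rewrite normrM [X in _ * X]gtr0_norm ?invr_gt0// ler0_norm; last by lra.
    by rewrite invfM mulrA; congr (_ * _); lra.
  rewrite cost_L_outside ?subr_ge0//.
  by have -> : b - a + (a - alpha) = b - alpha by lra.
have [ba|ba] := leP b alpha.
  rewrite triangle_integral_right// -EFinM; congr EFin.
  have -> : `|(alpha - (b + a) / 2) / (b - a)| = (b - a + 2 * (alpha - b)) / (2 * (b - a)).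
    rewrite normrM [X in _ * X]gtr0_norm ?invr_gt0// ger0_norm; last by lra.
    by rewrite invfM mulrA; congr (_ * _); lra.
  rewrite cost_L_outside ?subr_ge0//.
  by have -> : b - a + (alpha - b) = alpha - a by lra.
rewrite triangle_integral_mid// -EFinM; congr EFin.
have -> : (alpha - (b + a) / 2) / (b - a) =
    ((alpha - a) - (b - alpha)) / (2 * ((alpha - a) + (b - alpha))).
  have -> : (alpha - a) + (b - alpha) = b - a by lra.
  by rewrite invfM mulrA; congr (_ * _); lra.
have pE : b - a = (alpha - a) + (b - alpha) by lra.
by rewrite [in RHS]pE cost_L_inside ?subr_gt0// -pE.
Qed.

(** * Summation of the geometric series under the integral *)

Lemma esum_geometric (x : R) : 0 <= x < 1 ->
  (\esum_(i in [set: nat]) (x ^+ i)%:E = ((1 - x)^-1)%:E)%E.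
Proof.
move=> /andP[x0 x1].
have xn1 : x != 1 by rewrite lt_eqF.
rewrite -nneseries_esumT; last by move=> n; rewrite lee_fin exprn_ge0.
apply/cvg_lim => //.
have := @cvg_geometric_series R 1 x; rewrite ger0_norm// => /(_ x1); rewrite mul1r => h.
rewrite (_ : (fun n => _) = EFin \o series (geometric 1 x)); last first.
  apply/funext => n /=; rewrite /series/= -sumEFin; apply: eq_bigr => i _.
  by rewrite mul1r.
by apply: cvg_EFin => //; exact: nearW.
Qed.

Lemma measurable_inner_integral (g : R * R -> \bar R) (I : set R) :
  measurable I -> measurable_fun setT g -> (forall z, 0 <= g z)%E ->
  measurable_fun setT (fun v => \int[mu]_(t in I) g (v, t))%E.
Proof.
move=> mI mg g0.
have mE : measurable ([set: R] `*` I) by exact: measurableX.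
rewrite (_ : (fun v => _) = (fun v => \int[mu]_t (g \_ ([set: R] `*` I)) (v, t))%E).
  apply: (@measurable_fun_fubini_tonelli_F _ _ _ _ _ mu (g \_ ([set: R] `*` I))).
    by apply/(measurable_restrictT _ mE); exact: measurable_funTS.
  by move=> z; exact: erestrict_ge0.
apply/funext => v; rewrite integral_mkcond; apply: eq_integral => t _.
by rewrite !patchE in_setX/= in_setT.
Qed.

Variable alpha : R.

(* The probability that a seed is not in the hull of alpha, v and t; the maximum
   is 1 - hull_width for alpha, v, t in [0, 1]. *)
Definition avoid_prob (v t : R) : R := Order.max 0 (1 - hull_width alpha v t).

Lemma avoid_prob_ge0 v t : 0 <= avoid_prob v t.
Proof. by rewrite le_max lexx. Qed.

Lemma measurable_avoid_prob d (T : measurableType d) (f g : T -> R) :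
  measurable_fun setT f -> measurable_fun setT g ->
  measurable_fun setT (fun x => avoid_prob (f x) (g x)).
Proof.
move=> mf mg; apply: measurable_maxr => //; apply: measurable_funB => //.
exact: measurable_hull_width.
Qed.

Hypothesis alpha01 : 0 <= alpha <= 1.

Lemma hull_width_le1 v t : 0 <= v <= 1 -> 0 <= t <= 1 -> hull_width alpha v t <= 1.
Proof.
move=> /andP[v0 v1] /andP[t0 t1]; case/andP: alpha01 => a0 a1.
rewrite /hull_width lerBlDr; apply: (@le_trans _ _ 1).
  by rewrite /hull_right !ge_max a1 v1 t1.
by rewrite lerDl /hull_left !le_min a0 v0 t0.
Qed.

Lemma esum_avoid_prob (I : set R) : measurable I -> I `<=` `[0, 1] ->
  (\esum_(i in [set: nat])
     (\int[mu]_(v in I) (\int[mu]_(t in I) (avoid_prob v t ^+ i)%:E)) =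
   \int[mu]_(v in I) (\int[mu]_(t in I) ((hull_width alpha v t)^-1)%:E))%E.
Proof.
move=> mI I01.
pose g i (z : R * R) : \bar R := (avoid_prob z.1 z.2 ^+ i)%:E.
have mg i : measurable_fun setT (g i).
  apply/measurable_EFinP; apply: measurable_funX.
  by apply: measurable_avoid_prob; [exact: measurable_fst|exact: measurable_snd].
have g0 i z : (0 <= g i z)%E by rewrite lee_fin exprn_ge0// avoid_prob_ge0.
have mgv i v D : measurable_fun D (fun t => g i (v, t)).
  by apply: measurable_funTS; apply: (measurableT_comp (mg i)); exact: measurable_pair1.
rewrite -integral_esum//; last 2 first.
- by move=> i; apply: measurable_funTS; exact: (measurable_inner_integral mI (mg i) (g0 i)).
- by move=> i v; apply: integral_ge0 => t _; exact: (g0 i (v, t)).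
apply: eq_integral => v; rewrite inE => Iv.
rewrite -(@integral_esum _ _ _ mu I nat (fun i t => g i (v, t)))//; last first.
  by move=> i; exact: mgv.
have mIa : measurable (I `\ alpha) by exact: measurableD.
have mw : measurable_fun [set: R] (fun t => ((hull_width alpha v t)^-1)%:E).
  apply/measurable_EFinP; apply: measurableT_comp; first exact: measurable_inv.
  by apply: (@measurable_hull_width _ _ _ _ (cst v) id).
have mG : measurable_fun (I `\ alpha) (fun t => \esum_(i in [set: nat]) g i (v, t))%E.
  by apply: measurable_esum => [i|i t]; [exact: mgv|exact: g0].
(* At v = t = alpha the width is 0, the series diverges and the inverse is 0 by convention. Deleting
   the null point t = alpha makes the width positive throughout. *)
rewrite -[LHS](integral_setD1 mIa mG) -[RHS](@integral_setD1 _ _ alpha)//; last first.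
  exact: measurable_funTS.
apply: eq_integral => t; rewrite inE/= => -[It ta].
have w1 : hull_width alpha v t <= 1.
  by apply: hull_width_le1; [have := I01 _ Iv|have := I01 _ It]; rewrite /= in_itv.
have w0 : 0 < hull_width alpha v t.
  rewrite lt_neqAle hull_width_ge0 andbT eq_sym; apply/eqP => w0; apply: ta.
  have [la _ lt_ [ar _ tr]] := hull_minmax alpha v t.
  move/eqP: w0; rewrite /hull_width subr_eq0 => /eqP E.
  apply/eqP; rewrite eq_le; apply/andP; split.
    by apply: le_trans tr _; rewrite E.
  by apply: le_trans lt_; rewrite -E.
have qE : avoid_prob v t = 1 - hull_width alpha v t by rewrite /avoid_prob max_r// subr_ge0.
rewrite /g/= qE esum_geometric; first by rewrite opprB addrC subrK.
by rewrite subr_ge0 w1 ltrBlDr ltrDl.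
Qed.

End Cost.

(** * Integrals over the seeds of a prefix *)

Section SeedsIntegral.
Variables (R : realType) (Sigma : set nat) (M : R -> infinite_word).
Hypothesis hM : is_source Sigma M.
Local Notation mu := (@lebesgue_measure R).

Lemma seeds_sub01 w : seeds M w `<=` `[0, 1].
Proof. by move=> v [+ _]; apply: subset_itv_oo_cc. Qed.

(** Only the endpoints can distinguish the interval of seeds from the open one, and they are
    null. *)
Lemma integral_seeds w (f : R -> \bar R) : measurable_fun setT f ->
  (\int[mu]_(v in seeds M w) f v =
   \int[mu]_(v in `]prefix_left M w, prefix_right M w[) f v)%E.
Proof.
move=> mf; have /is_intervalP -> := @seeds_interval _ _ _ hM w.
have lb : has_lbound (seeds M w).
  by exists 0 => v /seeds_sub01; rewrite /= in_itv/= => /andP[].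
have ub : has_ubound (seeds M w).
  by exists 1 => v /seeds_sub01; rewrite /= in_itv/= => /andP[].
rewrite /Rhull (asboolT lb) (asboolT ub) integral_itv_bndoo//.
exact: measurable_funTS.
Qed.

Lemma seeds_integral_cost (alpha : R) w :
  (\int[mu]_(v in seeds M w) (\int[mu]_(t in seeds M w) ((hull_width alpha v t)^-1)%:E) =
   if (0 < prefix_prob M w)%R then
     (prefix_prob M w * cost_L `|(alpha - prefix_mid M w) / prefix_prob M w|)%:E
   else 0)%E.
Proof.
have mw : measurable_fun [set: R * R] (fun z => ((hull_width alpha z.1 z.2)^-1)%:E).
  apply/measurable_EFinP; apply: measurableT_comp; first exact: measurable_inv.
  by apply: measurable_hull_width; [exact: measurable_fst|exact: measurable_snd].
have w0 z : (0 <= ((hull_width alpha z.1 z.2)^-1)%:E)%E.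
  by rewrite lee_fin invr_ge0 hull_width_ge0.
rewrite integral_seeds; last first.
  exact: (measurable_inner_integral (measurable_seeds hM w) mw w0).
under eq_integral => v _.
  rewrite integral_seeds; last first.
    apply/measurable_EFinP; apply: measurableT_comp; first exact: measurable_inv.
    by apply: (@measurable_hull_width _ _ _ _ (cst v) id).
  over.
case: ifPn => [p0|]; last first.
  rewrite -leNgt subr_le0 => ba.
  by rewrite set_itv_ge ?integral_set0// -leNgt bnd_simp.
have ab : prefix_left M w < prefix_right M w by rewrite -subr_gt0.
by rewrite hull_integral_cost// /prefix_mid [in RHS](addrC (prefix_left M w)).
Qed.

End SeedsIntegral.

(** * Expectations *)

Section Uniform.
Variable R : realType.
Local Notation mu := (@lebesgue_measure R).
Local Notation unif := (uniform_prob (@ltr01 R)).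

Lemma uniform01_sub (A : set R) : measurable A -> A `<=` `[0, 1] -> unif A = mu A.
Proof.
move=> mA A01; rewrite /uniform_prob.
rewrite (eq_integral (fun=> 1%:E)); first by rewrite integral_cst// mul1e.
move=> x; rewrite inE => /A01; rewrite /= in_itv/= /uniform_pdf => ->.
by rewrite subr0 invr1.
Qed.

Lemma uniform01_itv (b1 b2 : bool) (l r : R) : 0 <= l -> l <= r -> r <= 1 ->
  unif [set` Interval (BSide b1 l) (BSide b2 r)] = (r - l)%:E.
Proof.
move=> l0 lr r1; rewrite uniform01_sub//; last first.
  move=> x /= xlr; have : x \in `[l, r].
    by move: xlr; case: b1; case: b2; rewrite !in_itv/= => /andP[? ?];
      apply/andP; split => //; exact: ltW.
  by rewrite !in_itv/= => /andP[lx xr]; rewrite (le_trans l0 lx) (le_trans xr r1).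
rewrite lebesgue_measure_itv/= lte_fin.
by case: ltgtP lr => [lr _|//|-> _]; rewrite ?subrr ?EFinB.
Qed.

Lemma integral_uniform01 (I : set R) (g : R -> \bar R) :
  measurable I -> I `<=` `[0, 1] -> measurable_fun setT g -> (forall t, 0 <= g t)%E ->
  (\int[unif]_(t in I) g t = \int[mu]_(t in I) g t)%E.
Proof.
move=> mI I01 mg g0; rewrite integral_mkcond integral_uniform; last 2 first.
- by apply/(measurable_restrictT _ mI); exact: measurable_funTS.
- by move=> t; exact: erestrict_ge0.
by rewrite subr0 invr1 mul1e -integral_mkcondr setIC (setIidl I01).
Qed.

End Uniform.

Section Expectation.
Variables (R : realType) (Sigma : set nat) (M : R -> infinite_word).
Hypothesis hM : is_source Sigma M.
Variable alpha : R.
Hypothesis alpha01 : 0 <= alpha <= 1.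
Context d (Omega : measurableType d) (P : probability Omega R).
Variable U : nat -> {RV P >-> R}.
Hypothesis hU : iid_uniform01 U.
Local Notation mu := (@lebesgue_measure R).
Local Notation unif := (uniform_prob (@ltr01 R)).

Let law i B : measurable B -> distribution P (U i) B = unif B.
Proof. exact: hU.2. Qed.

(* lebesgue_measure and uniform_prob live on measurableTypeR R, whose display
   differs from the one of R. *)
Let UR (i : nat) : {mfun Omega >-> measurableTypeR R} :=
  HB.pack (U i : Omega -> measurableTypeR R)
    (isMeasurableFun.Build _ _ Omega (measurableTypeR R) (U i) (measurable_funPT (U i))).

(** The value does not depend on b, because the endpoints of the hull are null: this is where the
    two bounds of S acquire the same expectation. *)
Lemma uniform01_avoid b v t : 0 <= v <= 1 -> 0 <= t <= 1 ->
  unif [set s | s \notin hull alpha b v t] = (avoid_prob alpha v t)%:E.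
Proof.
move=> v01 t01; have w1 := hull_width_le1 alpha01 v01 t01.
have -> : [set s | s \notin hull alpha b v t] = ~` [set` hull alpha b v t].
  by apply/seteqP; split=> s /= /negP.
rewrite probability_setC; last exact: measurable_itv.
have [la _ _ [ar _ _]] := hull_minmax alpha v t.
move: v01 t01 alpha01 => /andP[v0 v1] /andP[t0 t1] /andP[a0 a1].
rewrite [X in (1 - X)%E](_ : _ = (hull_width alpha v t)%:E).
  by rewrite -EFinB /avoid_prob max_r// subr_ge0.
apply: uniform01_itv; last 2 first.
- exact: le_trans la ar.
- by rewrite /hull_right !ge_max a1 v1 t1.
by rewrite /hull_left !le_min a0 v0 t0.
Qed.

Let region b i w : set (Omega * R) :=
  [set p | seeds M w p.2 /\ (seeds M w (U i p.1) /\
    forall j, (j < i)%N -> U j p.1 \notin hull alpha b p.2 (U i p.1))].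

Let measurable_region b i w : measurable (region b i w).
Proof.
have mU j : measurable_fun setT (fun p : Omega * R => U j p.1).
  by apply: measurableT_comp => //; exact: measurable_fst.
have -> : region b i w = (snd @^-1` seeds M w) `&` (((fun p => U i p.1) @^-1` seeds M w) `&`
    \bigcap_(j in `I_i) [set p | U j p.1 \notin hull alpha b p.2 (U i p.1)]).
  by apply/seteqP; split=> p.
apply: measurableI.
  rewrite -[X in measurable X]setTI; apply: measurable_snd => //.
  exact: (measurable_seeds hM).
apply: measurableI.
  by rewrite -[X in measurable X]setTI; apply: mU => //; exact: (measurable_seeds hM).
apply: bigcap_measurableType => j _.
by apply: measurable_notin_hull => //; exact: measurable_snd.
Qed.

Let common_regionE b i w omega :
  common_region M alpha b (fun j => U j omega) i w = xsection (region b i w) omega.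
Proof.
apply/seteqP; split=> v; rewrite /xsection/= inE => -[].
  by move=> [? ?] ?.
by move=> ? [? ?].
Qed.

Lemma measurable_common_region b i w :
  measurable_fun setT (fun omega => mu (common_region M alpha b (fun j => U j omega) i w)).
Proof.
under eq_fun do rewrite common_regionE.
exact: (measurable_fun_xsection mu (measurable_region b i w)).
Qed.

(** Tonelli puts v outside. For fixed v the event concerns [U i] and its predecessors only, and
    [iid_first_avoid] applies to the relation D of missing the hull. *)
Lemma expectation_common_region b i w :
  (\int[P]_omega mu (common_region M alpha b (fun j => U j omega) i w) =
   \int[mu]_(v in seeds M w) (\int[mu]_(t in seeds M w) (avoid_prob alpha v t ^+ i)%:E))%E.
Proof.
have mZ := measurable_region b i w.
transitivity (\int[P]_omega \int[mu]_v (\1_(region b i w) (omega, v))%:E)%E.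
  apply: eq_integral => omega _; rewrite common_regionE.
  rewrite -[xsection (region b i w) omega]setIT -integral_indic//; last exact: measurable_xsection.
  apply: eq_integral => v _; rewrite !indicE; congr ((_ : bool)%:R%:E).
  by rewrite mem_xsection.
transitivity (\int[mu]_v \int[P]_omega (\1_(region b i w) (omega, v))%:E)%E.
  apply: (fubini_tonelli (m1 := P) (m2 := mu) (fun z => (\1_(region b i w) z)%:E)).
    by apply/measurable_EFinP; exact: measurable_indic.
  by move=> z; rewrite lee_fin.
rewrite [RHS]integral_mkcond; apply: eq_integral => v _; rewrite patchE.
case: ifPn => wv; last first.
  apply: integral0_eq => omega _; rewrite indicE memNset// => -[/= wv' _].
  by move: wv; rewrite notin_setE.
have {}wv : seeds M w v := set_mem wv.
have v01 : 0 <= v <= 1 by have := seeds_sub01 wv; rewrite /= in_itv.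
pose D := [set p : R * R | p.2 \notin hull alpha b v p.1].
have mD : measurable D.
  by apply: (@measurable_notin_hull _ _ _ _ b (cst v)); [|exact: measurable_fst|exact: measurable_snd].
transitivity (P [set omega | seeds M w (U i omega) /\
    forall j, (j < i)%N -> D (U i omega, U j omega)]).
  rewrite -[X in _ = P X]setIT -integral_indic//; last first.
    rewrite [X in measurable X](_ : _ = ysection (region b i w) v).
      exact: measurable_ysection.
    by apply/seteqP; split=> omega; rewrite /ysection/= inE => // -[].
  apply: eq_integral => omega _; rewrite !indicE; congr ((_ : bool)%:R%:E).
  by apply/idP/idP; rewrite !inE => // -[].
rewrite (@iid_first_avoid _ _ _ _ _ P UR i hU.1 D (seeds M w) unif law mD (measurable_seeds hM w)).
transitivity (\int[unif]_(t in seeds M w) (avoid_prob alpha v t ^+ i)%:E)%E.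
  apply: eq_integral => t; rewrite inE => /seeds_sub01; rewrite /= in_itv/= => t01.
  have -> : xsection D t = [set s | s \notin hull alpha b v t].
    by apply/seteqP; split=> s; rewrite /xsection/= inE.
  by rewrite uniform01_avoid// EFin_expe.
rewrite integral_uniform01//.
- exact: (measurable_seeds hM).
- exact: seeds_sub01.
- apply/measurable_EFinP; apply: measurable_funX.
  by apply: (@measurable_avoid_prob _ _ _ _ (cst v) id).
- by move=> t; rewrite lee_fin exprn_ge0// avoid_prob_ge0.
Qed.

Lemma expectation_common_regions b :
  (\int[P]_omega (\esum_(i in [set: nat]) \esum_(w in [set: seq nat])
      mu (common_region M alpha b (fun j => U j omega) i w)) =
   \esum_(w in [set w | finite_words Sigma w /\ (0 < prefix_prob M w)%R])
     (prefix_prob M w *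
        cost_L `|(alpha - prefix_mid M w) / prefix_prob M w|)%:E)%E.
Proof.
have m0 i w omega : (0 <= mu (common_region M alpha b (fun j => U j omega) i w))%E.
  exact: measure_ge0.
rewrite integral_esum//; last 2 first.
- by move=> i; apply: measurable_esum => // w; exact: measurable_common_region.
- by move=> i omega; exact: esum_ge0.
under eq_esum => i _.
  rewrite integral_esum//; last by move=> w; exact: measurable_common_region.
  under eq_esum do rewrite expectation_common_region.
  over.
rewrite exchange_esum; last first.
  move=> i w; apply: integral_ge0 => v _; apply: integral_ge0 => t _.
  by rewrite lee_fin exprn_ge0// avoid_prob_ge0.
rewrite [RHS]esum_mkcond; apply: eq_esum => w _.
rewrite (esum_avoid_prob alpha01 (measurable_seeds hM w) (@seeds_sub01 _ _ w)).
rewrite (seeds_integral_cost hM).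
case: ifPn => [p0|np0]; last by rewrite memNset// => -[_ p0]; rewrite p0 in np0.
rewrite mem_set//; split=> // a aw.
(* A word of positive probability is a prefix of some [M x], so its letters are in Sigma; the sum
   over all of [seq nat] thus reduces to the finite words over Sigma. *)
have [x [x01 /has_prefixP wx]] : seeds M w !=set0.
  apply/set0P/eqP => E; move: p0.
  by rewrite /prefix_prob /prefix_left /prefix_right E inf0 sup0 subrr ltxx.
rewrite -(nth_index 0%N aw) -wx; last by rewrite index_mem.
exact: (source_letters hM x01).
Qed.

End Expectation.

(** * Almost sure properties of uniform seeds *)

Section AlmostSure.
Variables (R : realType).
Context d (Omega : measurableType d) (P : probability Omega R).
Variable U : nat -> {RV P >-> R}.
Hypothesis hU : iid_uniform01 U.
Local Notation unif := (uniform_prob (@ltr01 R)).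

Let measurable_preimage i (A : set R) : measurable A -> measurable (U i @^-1` A).
Proof. by move=> mA; rewrite -[X in measurable X]setTI; exact: measurable_funP. Qed.

Lemma ae_uniform01_open i : {ae P, forall omega, 0 < U i omega < 1}.
Proof.
have mI : measurable (`]0, 1[ : set R) by exact: measurable_itv.
exists (U i @^-1` (~` `]0, 1[)); split.
- by apply: measurable_preimage; exact: measurableC.
- rewrite -[LHS]/(distribution P (U i) _) hU.2; last exact: measurableC.
  by rewrite probability_setC// [X in (1 - X)%E]uniform01_itv// subr0 subee.
- by move=> omega /=; rewrite in_itv/=.
Qed.

Lemma ae_uniform01_neq (a : R) i : 0 <= a <= 1 -> {ae P, forall omega, U i omega != a}.
Proof.
move=> /andP[a0 a1].
exists (U i @^-1` `[a, a]); split.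
- by apply: measurable_preimage; exact: measurable_itv.
- rewrite -[LHS]/(distribution P (U i) _) hU.2; last exact: measurable_itv.
  by rewrite uniform01_itv// subrr.
- by move=> omega /= /negP/negPn/eqP ->; rewrite in_itv/= lexx.
Qed.

(** The first n seeds all miss the interval with probability (1 - (b - a))^n, which tends to 0. *)
Lemma ae_uniform01_hit (a b : R) : 0 <= a -> b <= 1 -> a < b ->
  {ae P, forall omega, exists i, a < U i omega < b}.
Proof.
move=> a0 b1 ab.
have mI : measurable (~` `]a, b[ : set R) by apply: measurableC; exact: measurable_itv.
pose N n := \bigcap_(j in [set` iota 0 n]) (U j @^-1` (~` `]a, b[)).
have mN n : measurable (N n).
  by apply: bigcap_measurableType => j _; exact: measurable_preimage.
have uE : unif (~` `]a, b[) = (1 - (b - a))%:E.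
  rewrite probability_setC; last exact: measurable_itv.
  by rewrite [X in (1 - X)%E]uniform01_itv// ltW.
have PN n : P (N n) = ((1 - (b - a)) ^+ n)%:E.
  rewrite (hU.1 (iota 0 n) (fun=> ~` `]a, b[) (iota_uniq _ _) (fun=> mI)).
  under eq_bigr do rewrite -[P _]/(distribution P (U _) _) hU.2// uE.
  by rewrite big_const_seq count_predT size_iota iter_mule mule1 EFin_expe.
exists (\bigcap_n N n); split.
- exact: bigcapT_measurable.
- have x1 : `|1 - (b - a)| < 1.
    by rewrite ger0_norm ?ltrBlDr ?ltrDl ?subr_gt0// subr_ge0; lra.
  apply/eqP; rewrite eq_le measure_ge0 andbT; apply/lee_addgt0Pr => e e0.
  have /cvgrPdist_lt/(_ e e0)[n _ /(_ n (leqnn n))] := cvg_expr x1.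
  rewrite /= sub0r normrN add0e => xn.
  apply: (@le_trans _ _ (P (N n))).
    by apply: le_measure; rewrite ?inE//; [exact: bigcapT_measurable|exact: bigcap_inf].
  by rewrite PN lee_fin ltW// (le_lt_trans (ler_norm _)).
- move=> omega /= nhit n _ j _ /=; rewrite in_itv/= => hit; apply: nhit.
  by exists j.
Qed.

(** The search intervals have random endpoints, so one null set must serve all a < b at once. Each
    such interval contains one with rational endpoints, and those are countably many. *)
Lemma ae_uniform01_dense : {ae P, forall omega, forall a b : R,
  0 <= a -> b <= 1 -> a < b -> exists i, a < U i omega < b}.
Proof.
have H : forall n, {ae P, forall omega,
    if unpickle n is Some (q, r) then
      0 <= ratr q :> R -> ratr r <= 1 :> R -> ratr q < ratr r :> R ->
      exists i, ratr q < U i omega < ratr r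
    else True}.
  move=> n; case: unpickle => [[q r]|]; last exact: aeW.
  have [q0|q0] := boolP (0 <= ratr q :> R); last by apply: aeW => omega.
  have [r1|r1] := boolP (ratr r <= 1 :> R); last by apply: aeW => omega.
  have [qr|qr] := boolP (ratr q < ratr r :> R); last by apply: aeW => omega.
  by apply: filterS (ae_uniform01_hit q0 r1 qr) => omega.
apply: filterS (ae_foralln H) => omega {}H a b a0 b1 ab.
have [q] := rat_in_itvoo ab; rewrite in_itv/= => /andP[aq qb].
have [r] := rat_in_itvoo qb; rewrite in_itv/= => /andP[qr rb].
have := H (pickle (q, r)); rewrite pickleK.
move=> /(_ (le_trans a0 (ltW aq)) (le_trans (ltW rb) b1) qr) [i /andP[qi ir]].
by exists i; rewrite (lt_trans aq qi) (lt_trans ir rb).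
Qed.

End AlmostSure.

Theorem mainTheorem5 (R : realType) (Sigma : set nat) (M : R -> infinite_word)
    (hM : is_source Sigma M) (alpha : R) (halpha : 0 <= alpha <= 1)
    (d : measure_display) (Omega : measurableType d) (P : probability Omega R)
    (U : nat -> {RV P >-> R}) (hU : iid_uniform01 U) :
  (\int[P]_omega search_cost M alpha (fun i : nat => U i omega) =
   \esum_(w in [set w | finite_words Sigma w /\ (0 < prefix_prob M w)%R])
     (prefix_prob M w *
        cost_L `|(alpha - prefix_mid M w) / prefix_prob M w|)%:E)%E.
Proof.
have good : {ae P, forall omega, [/\ forall i, 0 < U i omega < 1,
    forall i, U i omega != alpha &
    forall a b, 0 <= a -> b <= 1 -> a < b -> exists i, a < U i omega < b]}.
  have h1 := ae_foralln (ae_uniform01_open hU).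
  have h2 := ae_foralln (fun i => ae_uniform01_neq hU i halpha).
  have h3 := ae_uniform01_dense hU.
  by apply: filterS3 h1 h2 h3 => omega *; split.
have S0 omega : (0 <= search_cost M alpha (fun i => U i omega))%E.
  apply: nneseries_ge0 => k _ _; apply: integral_ge0 => v _.
  exact: beta_symb_ge0.
have Sb0 b omega : (0 <= \esum_(i in [set: nat]) \esum_(w in [set: seq nat])
    lebesgue_measure (common_region M alpha b (fun j => U j omega) i w))%E.
  by apply: esum_ge0 => i _; apply: esum_ge0 => w _; exact: measure_ge0.
apply/eqP; rewrite eq_le; apply/andP; split.
  rewrite -(expectation_common_regions hM halpha hU false).
  apply: ae_ge0_le_integralW => //; apply: filterS good => omega [u01 ua ud].
  exact: (search_cost_bounds hM halpha u01 ua ud).2.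
rewrite -(expectation_common_regions hM halpha hU true).
apply: ae_ge0_le_integralW => //; apply: filterS good => omega [u01 ua ud].
exact: (search_cost_bounds hM halpha u01 ua ud).1.
Qed.
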